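(* Let $\Omega\subseteq\mathbb{R}^n$ be open and let $R:\mathcal{G}_c(\Omega)\to\mathcal{G}(\Omega)$ be a $\widetilde{\mathbb{C}}$-linear map. (i) $R$ is an operator with generalized kernel if and only if it is a pseudodifferential operator with amplitude in $\widetilde{\mathcal{S}}^{-\infty}(\Omega\times\Omega\times\mathbb{R}^n)$. (ii) $R$ is an operator with regular generalized kernel if and only if it is a pseudodifferential operator with amplitude in $\widetilde{\mathcal{S}}^{-\infty}_{\mathrm{rg}}(\Omega\times\Omega\times\mathbb{R}^n)$.
   Context: Nets are indexed by $\varepsilon\in(0,1]$; $[(\cdot)_\varepsilon]$ denotes the class of a net; $O$-estimates are as $\varepsilon\to 0$; $K\Subset\Omega$ means $K$ is a compact subset of $\Omega$. $\widetilde{\mathbb{C}}$ is the ring of nets in $\mathbb{C}$ that are $O(\varepsilon^{-N})$ for some $N\in\mathbb{N}$, modulo nets that are $O(\varepsilon^q)$ for all $q\in\mathbb{N}$. For an open set $\Omega$, $\mathcal{G}(\Omega)$ consists of nets $(u_\varepsilon)_\varepsilon$ in $\mathcal{C}^\infty(\Omega)$ with $\forall K\Subset\Omega\,\forall\alpha\,\exists N$: $\sup_K|\partial^\alpha u_\varepsilon|=O(\varepsilon^{-N})$, modulo those with $\forall K\,\forall\alpha\,\forall q$: $\sup_K|\partial^\alpha u_\varepsilon|=O(\varepsilon^q)$. $\mathcal{G}^\infty(\Omega)$ is the set of $u\in\mathcal{G}(\Omega)$ having a representative with $\forall K\,\exists N\,\forall\alpha$: $\sup_K|\partial^\alpha u_\varepsilon|=O(\varepsilon^{-N})$.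 $\mathcal{G}_c(\Omega)$ is the set of compactly supported elements of $\mathcal{G}(\Omega)$ (they have representatives supported in a common compact set, and only these are used). $R$ is an operator with generalized kernel if there is $k\in\mathcal{G}(\Omega\times\Omega)$ with $Ru(x)=\int_\Omega k(x,y)u(y)\,dy$ for all $u\in\mathcal{G}_c(\Omega)$ (integral taken on representatives); it is an operator with regular generalized kernel if moreover $k\in\mathcal{G}^\infty(\Omega\times\Omega)$. For an open set $\Omega'\subseteq\mathbb{R}^{n'}$, $S^{-\infty}(\Omega'\times\mathbb{R}^n)$ is the space of smooth $a$ with all seminorms $|a|^{(m)}_{K,\alpha,\beta}=\sup_{z\in K,\xi\in\mathbb{R}^n}\langle\xi\rangle^{-m+|\alpha|}|\partial^\alpha_\xi\partial^\beta_z a(z,\xi)|$ finite ($m\in\mathbb{R}$, $K\Subset\Omega'$, $\alpha,\beta$ multi-indices, $\langle\xi\rangle=(1+|\xi|^2)^{1/2}$). $\widetilde{\mathcal{S}}^{-\infty}(\Omega'\times\mathbb{R}^n)$ is the quotient of nets in $S^{-\infty}$ for which every seminorm is $O(\varepsilon^{-N})$ for some $N$ (depending on the seminorm), modulo nets for which every seminorm is $O(\varepsilon^q)$ for all $q$. $\widetilde{\mathcal{S}}^{-\infty}_{\mathrm{rg}}(\Omega'\times\mathbb{R}^n)$ is the set of $a\in\widetilde{\mathcal{S}}^{-\infty}(\Omega'\times\mathbb{R}^n)$ such that for every $K\Subset\Omega'$ there is a representative with $\exists N\in\mathbb{N}\,\forall m\in\mathbb{R}\,\forall\alpha,\beta$: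 $|a_\varepsilon|^{(m)}_{K,\alpha,\beta}=O(\varepsilon^{-N})$. Here $\Omega'=\Omega\times\Omega$. The pseudodifferential operator with amplitude $a(x,y,\xi)$ is $u\mapsto\big[\big(\int_{\Omega\times\mathbb{R}^n}e^{i(x-y)\xi}a_\varepsilon(x,y,\xi)u_\varepsilon(y)\,dy\,(2\pi)^{-n}d\xi\big)_\varepsilon\big]$ from $\mathcal{G}_c(\Omega)$ to $\mathcal{G}(\Omega)$. *)

(* Defs.v *)
From HB Require Import structures.
From mathcomp Require Import all_boot all_order all_algebra.
From mathcomp Require Import generic_quotient ring_quotient.
From mathcomp Require Import all_classical all_reals all_analysis.
From mathcomp Require Import complex.

Set Implicit Arguments.
Unset Strict Implicit.
Unset Printing Implicit Defensive.

Import Order.TTheory GRing.Theory Num.Theory numFieldNormedType.Exports.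
Import Normc.

Local Open Scope classical_set_scope.
Local Open Scope ring_scope.
Local Open Scope complex_scope.
Local Open Scope quotient_scope.

Section Smooth.
Variables (R : realType) (d : nat).
Implicit Types (f g : 'rV[R]_d -> R[i]) (x : 'rV[R]_d) (U : set 'rV[R]_d).

Definition multi := {ffun 'I_d -> nat}.

Definition mdeg (a : multi) : nat := (\sum_(i < d) a i)%N.

Definition basis_vec (i : 'I_d) : 'rV[R]_d := delta_mx 0 i.

Definition re_fun f : 'rV[R]_d -> R := fun x => complex.Re (f x).
Definition im_fun f : 'rV[R]_d -> R := fun x => complex.Im (f x).

Definition partial (i : 'I_d) f : 'rV[R]_d -> R[i] :=
  fun x => 'D_(basis_vec i) (re_fun f) x +i* 'D_(basis_vec i) (im_fun f) x.

Definition partials (s : seq 'I_d) f : 'rV[R]_d -> R[i] := foldr partial f s.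

Definition mderiv (a : multi) f : 'rV[R]_d -> R[i] :=
  partials (flatten [seq nseq (a i) i | i <- enum 'I_d]) f.

(* [f] is C^oo on the open set [U]; the values of [f] outside of [U] are
   irrelevant. *)
Definition smooth U f : Prop :=
  forall (s : seq 'I_d) x, U x ->
    [/\ {for x, continuous (re_fun (partials s f))},
        {for x, continuous (im_fun (partials s f))} &
        forall i : 'I_d, derivable (re_fun (partials s f)) x (basis_vec i) /\
                         derivable (im_fun (partials s f)) x (basis_vec i)].

End Smooth.


Section SmoothTheory.
Variables (R : realType) (d : nat) (U : set 'rV[R]_d).
Hypothesis oU : open U.
Implicit Types f g : 'rV[R]_d -> R[i].

Let re_lin (c : R[i]) f g : re_fun (c *: f + g) =
  (complex.Re c \*: re_fun f) + ((- complex.Im c) \*: im_fun f) + re_fun g.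
Proof.
apply/funext => x; rewrite /re_fun /im_fun !fctE /= /GRing.scale /=.
by case: c (f x) (g x) => [a b] [a' b'] [a'' b''] /=; rewrite mulNr.
Qed.

Let im_lin (c : R[i]) f g : im_fun (c *: f + g) =
  (complex.Re c \*: im_fun f) + (complex.Im c \*: re_fun f) + im_fun g.
Proof.
apply/funext => x; rewrite /re_fun /im_fun !fctE /= /GRing.scale /=.
by case: c (f x) (g x) => [a b] [a' b'] [a'' b''].
Qed.

Lemma near_open x (P : 'rV[R]_d -> Prop) :
  U x -> (forall y, U y -> P y) -> \forall y \near x, P y.
Proof.
by move=> Ux UP; have := open_nbhs_nbhs (conj oU Ux); exact: filterS.
Qed.

Let derive_lin3 (a b : R) (h k l : 'rV[R]_d -> R) (x v : 'rV[R]_d) :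
  derivable h x v -> derivable k x v -> derivable l x v ->
  'D_v ((a \*: h) + (b \*: k) + l) x =
  a * 'D_v h x + b * 'D_v k x + 'D_v l x.
Proof.
move=> dh dk dl.
have dah : derivable (a \*: h) x v by exact: derivableZ.
have dbk : derivable (b \*: k) x v by exact: derivableZ.
have -> := deriveD (derivableD dah dbk) dl.
by have -> := deriveD dah dbk; rewrite (deriveZ _ dh) (deriveZ _ dk).
Qed.

Let derivable_lin3 (a b : R) (h k l : 'rV[R]_d -> R) (x v : 'rV[R]_d) :
  derivable h x v -> derivable k x v -> derivable l x v ->
  derivable ((a \*: h) + (b \*: k) + l) x v.
Proof.
move=> dh dk dl.
have dah : derivable (a \*: h) x v by exact: derivableZ.
have dbk : derivable (b \*: k) x v by exact: derivableZ.
exact: (derivableD (derivableD dah dbk) dl).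
Qed.

Let continuous_lin3 (a b : R) (h k l : 'rV[R]_d -> R) (x : 'rV[R]_d) :
  {for x, continuous h} -> {for x, continuous k} -> {for x, continuous l} ->
  {for x, continuous ((a \*: h) + (b \*: k) + l)}.
Proof.
move=> ch ck cl.
have cah : {for x, continuous (a \*: h)} by exact: continuousZl_tmp.
have cbk : {for x, continuous (b \*: k)} by exact: continuousZl_tmp.
exact: (continuousD (continuousD cah cbk) cl).
Qed.

Lemma partials_lin (c : R[i]) f g : smooth U f -> smooth U g ->
  forall s x, U x ->
    partials s (c *: f + g) x = c * partials s f x + partials s g x.
Proof.
move=> sf sg; elim=> [//|i s IH] x Ux /=.
set F := partials s (c *: f + g).
set G := c *: partials s f + partials s g.
have FG : \forall y \near x, F y = G y by apply: near_open Ux IH.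
have [_ _ /(_ i) [dfr dfi]] := sf s x Ux.
have [_ _ /(_ i) [dgr dgi]] := sg s x Ux.
rewrite /partial.
have -> : 'D_(basis_vec R i) (re_fun F) x = 'D_(basis_vec R i) (re_fun G) x.
  by apply: near_eq_derive; apply: filterS FG => y; rewrite /re_fun => ->.
have -> : 'D_(basis_vec R i) (im_fun F) x = 'D_(basis_vec R i) (im_fun G) x.
  by apply: near_eq_derive; apply: filterS FG => y; rewrite /im_fun => ->.
rewrite /G re_lin im_lin.
rewrite (derive_lin3 _ _ dfr dfi dgr) (derive_lin3 _ _ dfi dfr dgi).
by case: (c) => a b; rewrite /GRing.scale /= mulNr.
Qed.

Lemma smooth_lin (c : R[i]) f g :
  smooth U f -> smooth U g -> smooth U (c *: f + g).
Proof.
move=> sf sg s x Ux.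
set F := partials s (c *: f + g).
set G := c *: partials s f + partials s g.
have FG : \forall y \near x, F y = G y.
  by apply: near_open Ux _ => y Uy; exact: partials_lin.
have [cfr cfi dfs] := sf s x Ux.
have [cgr cgi dgs] := sg s x Ux.
have FGr : \forall y \near x, re_fun G y = re_fun F y.
  by apply: filterS FG => y; rewrite /re_fun => ->.
have FGi : \forall y \near x, im_fun G y = im_fun F y.
  by apply: filterS FG => y; rewrite /im_fun => ->.
have cts (h k : 'rV[R]_d -> R) : (\forall y \near x, h y = k y) ->
  {for x, continuous h} -> {for x, continuous k}.
  rewrite /prop_for /continuous_at => hk hx.
  rewrite -(nbhs_singleton hk); apply: cvg_trans hx.
  exact: (@near_eq_cvg _ _ (nbhs x) _ h k hk).
split.
- by apply: cts FGr _; rewrite /G re_lin; exact: continuous_lin3.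
- by apply: cts FGi _; rewrite /G im_lin; exact: continuous_lin3.
- move=> i; have [dfr dfi] := dfs i; have [dgr dgi] := dgs i; split.
  + by apply: near_eq_derivable FGr _; rewrite /G re_lin; exact: derivable_lin3.
  + by apply: near_eq_derivable FGi _; rewrite /G im_lin; exact: derivable_lin3.
Qed.

Lemma partial_cst (k : R[i]) i : partial i (cst k : 'rV[R]_d -> R[i]) = 0.
Proof.
apply/funext => x; rewrite /partial.
have -> : re_fun (cst k : 'rV[R]_d -> R[i]) = cst (complex.Re k) by [].
have -> : im_fun (cst k : 'rV[R]_d -> R[i]) = cst (complex.Im k) by [].
by rewrite !derive_cst.
Qed.

Lemma partials0 s : partials s (0 : 'rV[R]_d -> R[i]) = 0.
Proof. by elim: s => //= i s ->; exact: partial_cst. Qed.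

Lemma smooth0 : smooth U (0 : 'rV[R]_d -> R[i]).
Proof.
move=> s x Ux; rewrite partials0.
have -> : re_fun (0 : 'rV[R]_d -> R[i]) = cst 0 by [].
have -> : im_fun (0 : 'rV[R]_d -> R[i]) = cst 0 by [].
by split=> [||i]; [exact: cst_continuous|exact: cst_continuous|split; exact: derivable_cst].
Qed.

End SmoothTheory.


Section Normc.
Variable R : realType.

Lemma normc_ge0 (z : R[i]) : 0 <= normc z.
Proof. by case: z => a b /=; exact: sqrtr_ge0. Qed.

End Normc.

Section Growth.
Variable R : realType.

Definition eps : Type := {e : R | (0 < e) && (e <= 1)}.

Fact eps_one_subproof : (0 < 1 :> R) && (1 <= 1 :> R).
Proof. by rewrite ltr01 lexx. Qed.

HB.instance Definition _ := Choice.on eps.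
HB.instance Definition _ :=
  isPointed.Build eps (exist _ (1 : R) eps_one_subproof).

Lemma eps_gt0 (e : eps) : 0 < val e. Proof. by case: e => e /= /andP[]. Qed.
Lemma eps_le1 (e : eps) : val e <= 1. Proof. by case: e => e /= /andP[]. Qed.

(* p_e = O(g_e) as e -> 0; the name avoids the [bigO] of landau. *)
Definition epsO (p : eps -> \bar R) (g : eps -> R) : Prop :=
  exists C eta : R,
    0 < eta /\ forall e : eps, val e < eta -> (p e <= (C * g e)%:E)%E.

Implicit Types (p q : eps -> \bar R) (g h : eps -> R).

Lemma epsO_pos p g : (forall e, 0 <= g e) -> epsO p g ->
  exists C eta : R, [/\ 0 < C, 0 < eta &
    forall e : eps, val e < eta -> (p e <= (C * g e)%:E)%E].
Proof.
move=> g0 [C [eta [eta0 H]]]; exists (`|C| + 1), eta; split => //.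
move=> e /H /le_trans; apply; rewrite lee_fin ler_wpM2r//.
by rewrite (le_trans (ler_norm C))// lerDl.
Qed.

Lemma epsO_le p q g : (forall e, (p e <= q e)%E) -> epsO q g -> epsO p g.
Proof.
move=> pq [C [eta [eta0 H]]]; exists C, eta; split => // e ee.
exact: le_trans (pq e) (H e ee).
Qed.

Lemma epsO_D p q g : epsO p g -> epsO q g -> epsO (fun e => (p e + q e)%E) g.
Proof.
move=> [C [eta [eta0 H]]] [D [del [del0 K]]].
exists (C + D), (Num.min eta del); split; first by rewrite lt_min eta0.
move=> e; rewrite lt_min => /andP[/H pe /K qe].
by rewrite mulrDl EFinD leeD.
Qed.

Lemma epsO_M (r : eps -> R) p g h : (forall e, 0 <= r e) ->
  (forall e, 0 <= g e) -> (forall e, 0 <= h e) ->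
  epsO (fun e => (r e)%:E) g -> epsO p h ->
  epsO (fun e => ((r e)%:E * p e)%E) (fun e => g e * h e).
Proof.
move=> r0 g0 h0 /(epsO_pos g0)[C [eta [C0 eta0 H]]].
move=> /(epsO_pos h0)[D [del [D0 del0 K]]].
exists (C * D), (Num.min eta del); split; first by rewrite lt_min eta0.
move=> e; rewrite lt_min => /andP[/H re /K pe].
apply: (@le_trans _ _ ((r e)%:E * (D * h e)%:E)%E).
  by rewrite lee_wpmul2l// lee_fin.
rewrite -EFinM lee_fin mulrACA; apply: ler_wpM2r; last by rewrite -lee_fin.
exact: mulr_ge0 (ltW D0) (h0 e).
Qed.

Lemma epsO_gauge p g h : (forall e, 0 <= g e) -> (forall e, g e <= h e) ->
  epsO p g -> epsO p h.
Proof.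
move=> g0 gh /(epsO_pos g0)[C [eta [C0 eta0 H]]].
exists C, eta; split => // e /H /le_trans; apply.
by rewrite lee_fin ler_wpM2l// ltW.
Qed.

Lemma epsX_ge0 n (e : eps) : 0 <= val e ^+ n.
Proof. by rewrite exprn_ge0// ltW// eps_gt0. Qed.

Lemma epsXN_ge0 n (e : eps) : 0 <= val e ^- n.
Proof. by rewrite invr_ge0 epsX_ge0. Qed.

Lemma epsX_le m n (e : eps) : (m <= n)%N -> val e ^+ n <= val e ^+ m.
Proof. by move=> mn; rewrite ler_wiXn2l ?eps_le1// ltW// eps_gt0. Qed.

Lemma epsXN_le m n (e : eps) : (m <= n)%N -> val e ^- m <= val e ^- n.
Proof.
by move=> mn; rewrite lef_pV2 ?posrE ?exprn_gt0 ?eps_gt0//; exact: epsX_le.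
Qed.

Lemma epsO_moderateD p q :
  (exists N, epsO p (fun e => val e ^- N)) ->
  (exists N, epsO q (fun e => val e ^- N)) ->
  exists N, epsO (fun e => (p e + q e)%E) (fun e => val e ^- N).
Proof.
move=> [M pM] [N qN]; exists (maxn M N); apply: epsO_D.
- apply: epsO_gauge pM => e; first exact: epsXN_ge0.
  by apply: epsXN_le; rewrite leq_maxl.
- apply: epsO_gauge qN => e; first exact: epsXN_ge0.
  by apply: epsXN_le; rewrite leq_maxr.
Qed.

Lemma epsO_moderateM (r : eps -> R) p : (forall e, 0 <= r e) ->
  (exists N, epsO (fun e => (r e)%:E) (fun e => val e ^- N)) ->
  (exists N, epsO p (fun e => val e ^- N)) ->
  exists N, epsO (fun e => ((r e)%:E * p e)%E) (fun e => val e ^- N).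
Proof.
move=> r0 [M pM] [N qN]; exists (M + N)%N.
have := epsO_M r0 (epsXN_ge0 M) (epsXN_ge0 N) pM qN.
by congr (epsO _ _); apply/funext => e; rewrite exprD invfM mulrC.
Qed.

Lemma epsO_negligibleMl (r : eps -> R) p : (forall e, 0 <= r e) ->
  (exists N, epsO (fun e => (r e)%:E) (fun e => val e ^- N)) ->
  (forall n, epsO p (fun e => val e ^+ n)) ->
  forall n, epsO (fun e => ((r e)%:E * p e)%E) (fun e => val e ^+ n).
Proof.
move=> r0 [M rM] pn n.
have := epsO_M r0 (epsXN_ge0 M) (epsX_ge0 (M + n)) rM (pn (M + n)%N).
congr (epsO _ _); apply/funext => e.
by rewrite exprD mulKf// expf_neq0// gt_eqF// eps_gt0.
Qed.

Lemma epsO_negligibleMr (r : eps -> R) p : (forall e, 0 <= r e) ->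
  (forall n, epsO (fun e => (r e)%:E) (fun e => val e ^+ n)) ->
  (exists N, epsO p (fun e => val e ^- N)) ->
  forall n, epsO (fun e => ((r e)%:E * p e)%E) (fun e => val e ^+ n).
Proof.
move=> r0 rn [M pM] n.
have := epsO_M r0 (epsX_ge0 (n + M)) (epsXN_ge0 M) (rn (n + M)%N) pM.
congr (epsO _ _); apply/funext => e.
by rewrite exprD mulfK// expf_neq0// gt_eqF// eps_gt0.
Qed.

Lemma not_epsO1 : ~ epsO (fun=> 1%E) (fun e => val e ^+ 1).
Proof.
move=> /(epsO_pos (epsX_ge0 1))[C [eta [C0 eta0 H]]].
pose t := Num.min (Num.min (eta / 2) 1) (C^-1 / 2).
have t0 : 0 < t by rewrite !lt_min !divr_gt0// ?ltr01 ?invr_gt0.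
have t1 : t <= 1 by rewrite !ge_min lexx orbT.
have te : (0 < t) && (t <= 1) by rewrite t0.
have tlt : t < eta.
  by rewrite /t !gt_min ltr_pdivrMr// ltr_pMr// ltrDl ltr01.
have := H (exist _ t te) tlt; rewrite lee_fin expr1 leNgt => /negP; apply.
rewrite -ltr_pdivlMl// mulr1.
have : t <= C^-1 / 2 by rewrite ge_min lexx orbT.
move=> /le_lt_trans; apply.
by rewrite ltr_pdivrMr// ltr_pMr ?invr_gt0// ltrDl ltr01.
Qed.

End Growth.

(* A complex vector space with a family of seminorms. C, C^oo(O) and S^{-oo} are
   all instances, and C~, G(O) and S~^{-oo} are all obtained from them as
   moderate nets modulo negligible ones. The seminorms take values in [\bar R]
   because they are suprema, equal to -oo over the empty compact set. *)
Record snspace (R : realType) := SNSpace {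
  sn_sort :> lmodType R[i];
  sn_idx : Type;
  sn : sn_idx -> sn_sort -> \bar R;
  sn0_le : forall j, (sn j 0 <= 0)%E;
  snD_le : forall j u v, (sn j (u + v) <= sn j u + sn j v)%E;
  snZ_le : forall j c u, (sn j (c *: u) <= (normc c)%:E * sn j u)%E }.

Section ModerateNegligible.
Variables (R : realType) (E : snspace R).
Implicit Types u v : eps R -> E.

Definition moderate u : Prop := forall j : sn_idx E,
  exists N : nat, epsO (fun e => sn j (u e)) (fun e => val e ^- N).

Definition negligible u : Prop := forall (j : sn_idx E) (q : nat),
  epsO (fun e => sn j (u e)) (fun e => val e ^+ q).

Lemma moderate0 : moderate 0.
Proof.
move=> j; exists 0%N; exists 1, 1; split => // e _.
by rewrite expr0 invr1 mulr1 (le_trans (sn0_le j))// lee_fin.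
Qed.

Lemma moderateZD (c : eps R -> R[i]) u v :
  (exists N, epsO (fun e => (normc (c e))%:E) (fun e => val e ^- N)) ->
  moderate u -> moderate v -> moderate (fun e => c e *: u e + v e).
Proof.
move=> mc mu mv j.
have [N HN] := epsO_moderateD
  (epsO_moderateM (fun e => normc_ge0 (c e)) mc (mu j)) (mv j).
exists N; apply: epsO_le HN => e.
apply: (le_trans (@snD_le R E j _ _)); rewrite leeD2r//; exact: snZ_le.
Qed.

Lemma negligible0 : negligible 0.
Proof.
move=> j q; exists 0, 1; split => // e _; rewrite mul0r; exact: sn0_le.
Qed.

Lemma negligibleD u v : negligible u -> negligible v -> negligible (u + v).
Proof.
move=> nu nv j q; apply: epsO_le (epsO_D (nu j q) (nv j q)) => e.
exact: snD_le.
Qed.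

Lemma negligibleZl (c : eps R -> R[i]) u :
  (exists N, epsO (fun e => (normc (c e))%:E) (fun e => val e ^- N)) ->
  negligible u -> negligible (fun e => c e *: u e).
Proof.
move=> mc nu j q.
apply: epsO_le (epsO_negligibleMl (fun e => normc_ge0 (c e)) mc (nu j) q) => e.
exact: snZ_le.
Qed.

Lemma negligibleZr (c : eps R -> R[i]) u :
  (forall n, epsO (fun e => (normc (c e))%:E) (fun e => val e ^+ n)) ->
  moderate u -> negligible (fun e => c e *: u e).
Proof.
move=> nc mu j q.
apply: epsO_le (epsO_negligibleMr (fun e => normc_ge0 (c e)) nc (mu j) q) => e.
exact: snZ_le.
Qed.

Definition moderate_pred : pred (eps R -> E) := fun u => `[< moderate u >].

Lemma epsO_cst (z : R[i]) :
  exists N, epsO (fun _ : eps R => (normc z)%:E) (fun e => val e ^- N).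
Proof.
exists 0%N, (normc z), 1; split => // e _.
by rewrite expr0 invr1 mulr1.
Qed.

Fact moderate_zmod_closed : zmod_closed moderate_pred.
Proof.
split; first by apply/asboolP; exact: moderate0.
move=> u v /asboolP mu /asboolP mv; apply/asboolP.
have -> : u - v = fun e => (-1) *: v e + u e.
  by apply/funext => e; rewrite scaleN1r addrC.
by apply: moderateZD => //; exact: epsO_cst.
Qed.

HB.instance Definition _ := GRing.isZmodClosed.Build (eps R -> E) moderate_pred
  moderate_zmod_closed.

Record modnet := ModNet {
  modnet_net :> eps R -> E;
  modnet_moderate : modnet_net \in moderate_pred }.

HB.instance Definition _ := [isSub for modnet_net].
HB.instance Definition _ := [Choice of modnet by <:].
HB.instance Definition _ := [SubChoice_isSubZmodule of modnet by <:].

Definition negligible_pred : pred modnet := fun w : modnet => `[< negligible w >].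

Fact negligible_zmod_closed : zmod_closed negligible_pred.
Proof.
split; first by apply/asboolP; exact: negligible0.
move=> u v /asboolP nu /asboolP nv; apply/asboolP.
have -> : modnet_net (u - v) = modnet_net u + (fun e => (-1) *: v e).
  by apply/funext => e; rewrite fctE /= scaleN1r.
by apply: negligibleD => //; apply: negligibleZl => //; exact: epsO_cst.
Qed.

HB.instance Definition _ := GRing.isZmodClosed.Build modnet negligible_pred
  negligible_zmod_closed.

Definition colombeau : Type := Quotient.quot (GRing.ZmodClosed.clone modnet negligible_pred _).

HB.instance Definition _ := Choice.on colombeau.
HB.instance Definition _ := GRing.Zmodule.on colombeau.

Definition class_of (u : modnet) : colombeau := \pi u.

End ModerateNegligible.
Section ComplexSpace.
Variable R : realType.

Definition complex_sn (_ : unit) (z : R[i]) : \bar R := (normc z)%:E.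

Fact complex_sn0 j : (complex_sn j 0%R <= 0)%E.
Proof. by rewrite /complex_sn normc0. Qed.

Fact complex_snD j u v : (complex_sn j (u + v)%R <= complex_sn j u + complex_sn j v)%E.
Proof. by rewrite /complex_sn -EFinD lee_fin le_normcD. Qed.

Fact complex_snZ j c u : (complex_sn j (c *: u)%R <= (normc c)%:E * complex_sn j u)%E.
Proof. by rewrite /complex_sn -EFinM lee_fin normcM. Qed.

Definition complex_space : snspace R :=
  SNSpace complex_sn0 complex_snD complex_snZ.

Definition moderatec : pred (eps R -> R[i]) :=
  fun c => `[< moderate (E := complex_space) c >].

Lemma moderatecP (c : eps R -> R[i]) : reflect
  (exists N, epsO (fun e => (normc (c e))%:E) (fun e => val e ^- N))
  (c \in moderatec).
Proof.
by apply: (iffP (asboolP _)) => [/(_ tt)//|H []].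
Qed.

Fact moderatec_subring : subring_closed moderatec.
Proof.
split.
- by apply/moderatecP; exact: epsO_cst.
- move=> u v uM vM.
  by move: (@moderate_zmod_closed _ complex_space) => [_]; exact.
- move=> u v /moderatecP uM /moderatecP vM; apply/moderatecP.
  have [N HN] := epsO_moderateM (fun e => normc_ge0 (u e)) uM vM.
  exists N; move: HN; congr (epsO _ _).
  by apply/funext => e; rewrite normcM EFinM.
Qed.

HB.instance Definition _ := GRing.isSubringClosed.Build (eps R -> R[i]) moderatec
  moderatec_subring.

Record modcnet := ModCNet {
  modcnet_net :> eps R -> R[i];
  modcnet_moderate : modcnet_net \in moderatec }.

HB.instance Definition _ := [isSub for modcnet_net].
HB.instance Definition _ := [Choice of modcnet by <:].
HB.instance Definition _ := [SubChoice_isSubComNzRing of modcnet by <:].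

Definition negligiblec : pred modcnet :=
  fun c => `[< negligible (E := complex_space) c >].

Lemma negligiblecP (c : modcnet) : reflect
  (forall q, epsO (fun e => (normc (c e))%:E) (fun e => val e ^+ q))
  (c \in negligiblec).
Proof.
by apply: (iffP (asboolP _)) => [/(_ tt)//|H []].
Qed.

Fact negligiblec_idealr : idealr_closed negligiblec.
Proof.
split.
- by apply/asboolP; exact: (@negligible0 _ complex_space).
- apply/negP => /negligiblecP/(_ 1%N).
  have -> : (fun e => (normc ((1 : modcnet) e))%:E) = (fun=> 1%E).
    by apply/funext => e; rewrite (_ : (1 : modcnet) e = 1) ?normc1.
  exact: not_epsO1.
- move=> a u v /negligiblecP uN /asboolP vN; apply/asboolP.
  apply: (@negligibleD _ complex_space (a * u : modcnet)) => //.
  apply/asboolP/negligiblecP => q.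
  have /moderatecP aM := modcnet_moderate a.
  have := epsO_negligibleMl (fun e => normc_ge0 (a e)) aM uN q.
  by congr (epsO _ _); apply/funext => e; rewrite /= normcM EFinM.
Qed.

HB.instance Definition _ := isIdealr.Build modcnet negligiblec
  negligiblec_idealr.

Definition Ctilde : Type := {ideal_quot (Idealr.clone modcnet negligiblec _)}.

HB.instance Definition _ := Choice.on Ctilde.
HB.instance Definition _ := GRing.ComNzRing.on Ctilde.

Definition classc_of (c : modcnet) : Ctilde := \pi c.

End ComplexSpace.

Section GenModule.
Variables (R : realType) (E : snspace R).
Implicit Types (c : modcnet R) (u v : modnet E).

Fact modnet_scale_subproof c u : (fun e => c e *: u e) \in @moderate_pred R E.
Proof.
apply/asboolP.
have -> : (fun e => c e *: u e) = (fun e => c e *: u e + (0 : eps R -> E) e).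
  by apply/funext => e; rewrite addr0.
apply: moderateZD; [|exact/asboolP/modnet_moderate|exact: moderate0].
exact/moderatecP/modcnet_moderate.
Qed.

Definition modnet_scale c u : modnet E := ModNet (modnet_scale_subproof c u).

Lemma class_ofP u v : class_of u = class_of v <-> negligible (u - v : modnet E).
Proof.
split=> [/eqP|/asboolP uv]; last first.
  by apply/eqP; rewrite /class_of -Quotient.idealrBE.
by rewrite /class_of -Quotient.idealrBE => /asboolP.
Qed.

Lemma classc_ofP (c d : modcnet R) : classc_of c = classc_of d <->
  (c - d) \in @negligiblec R.
Proof.
by split=> [/eqP|cd]; [|apply/eqP]; rewrite /classc_of -Quotient.idealrBE.
Qed.

Lemma class_ofK (x : colombeau E) : class_of (repr x) = x.
Proof. exact: reprK. Qed.

Lemma classc_ofK (x : Ctilde R) : classc_of (repr x) = x.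
Proof. exact: reprK. Qed.

Lemma class_ofD u v : class_of (u + v) = class_of u + class_of v.
Proof. by rewrite /class_of !piE. Qed.

Lemma classc_ofD (c d : modcnet R) :
  classc_of (c + d) = classc_of c + classc_of d.
Proof. by rewrite /classc_of !piE. Qed.

Lemma classc_ofM (c d : modcnet R) :
  classc_of (c * d) = classc_of c * classc_of d.
Proof. by rewrite /classc_of !piE. Qed.

Lemma classc_of1 : classc_of (1 : modcnet R) = 1.
Proof. by rewrite /classc_of !piE. Qed.

Definition colombeau_scale (c : Ctilde R) (u : colombeau E) : colombeau E :=
  class_of (modnet_scale (repr c) (repr u)).

Lemma colombeau_scaleE c u :
  colombeau_scale (classc_of c) (class_of u) = class_of (modnet_scale c u).
Proof.
set c' := repr (classc_of c); set u' := repr (class_of u).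
apply/class_ofP.
have /classc_ofP/negligiblecP cc : classc_of c' = classc_of c.
  exact: classc_ofK.
have /class_ofP uu : class_of u' = class_of u by exact: class_ofK.
have -> : modnet_net (modnet_scale c' u' - modnet_scale c u) =
  (fun e => (c' - c : modcnet R) e *: u' e) +
  (fun e => c e *: (u' - u : modnet E) e).
  apply/funext => e; rewrite fctE /=.
  by rewrite !fctE scalerBl scalerBr addrA subrK.
apply: negligibleD.
- by apply: negligibleZr => //; exact/asboolP/modnet_moderate.
- by apply: negligibleZl => //; exact/moderatecP/modcnet_moderate.
Qed.

Fact colombeau_scalerA a b (u : colombeau E) :
  colombeau_scale a (colombeau_scale b u) = colombeau_scale (a * b) u.
Proof.
rewrite -(classc_ofK a) -(classc_ofK b) -(class_ofK u).
rewrite -classc_ofM !colombeau_scaleE; congr class_of; apply: val_inj.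
by apply/funext => e /=; rewrite scalerA.
Qed.

Fact colombeau_scale1r : left_id 1 colombeau_scale.
Proof.
move=> u; rewrite -(class_ofK u) -classc_of1 colombeau_scaleE; congr class_of.
by apply: val_inj; apply/funext => e /=; rewrite scale1r.
Qed.

Fact colombeau_scalerDr : right_distributive colombeau_scale +%R.
Proof.
move=> a u v; rewrite -(classc_ofK a) -(class_ofK u) -(class_ofK v).
rewrite -class_ofD !colombeau_scaleE -class_ofD; congr class_of; apply: val_inj.
by apply/funext => e /=; rewrite scalerDr.
Qed.

Fact colombeau_scalerDl (u : colombeau E) :
  {morph colombeau_scale^~ u : a b / a + b >-> a + b}.
Proof.
move=> a b; rewrite -(classc_ofK a) -(classc_ofK b) -(class_ofK u).
rewrite -classc_ofD !colombeau_scaleE -class_ofD; congr class_of; apply: val_inj.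
by apply/funext => e /=; rewrite scalerDl.
Qed.

HB.instance Definition _ := GRing.Zmodule_isLmodule.Build (Ctilde R) (colombeau E)
  colombeau_scalerA colombeau_scale1r colombeau_scalerDr colombeau_scalerDl.

End GenModule.

Record openset (R : realType) (d : nat) := OpenSet {
  oset :> set 'rV[R]_d;
  oset_open : open oset }.

Arguments oset_open {R d} o.

Definition cart_set (R : realType) (m n : nat) (A : set 'rV[R]_m)
    (B : set 'rV[R]_n) : set 'rV[R]_(m + n) :=
  [set z | A (lsubmx z) /\ B (rsubmx z)].

Lemma open_cart_set (R : realType) (m n : nat) (A : set 'rV[R]_m)
  (B : set 'rV[R]_n) : open A -> open B -> open (cart_set A B).
Proof.
rewrite !openE => oA oB z [/oA Az /oB Bz].
have [r1 /= r10 Ar] := (@nbhs_ballP _ _ _ _).1 Az.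
have [r2 /= r20 Br] := (@nbhs_ballP _ _ _ _).1 Bz.
apply/nbhs_ballP; exists (Num.min r1 r2); first by rewrite /= lt_min r10.
move=> y; rewrite /ball /= => -[_ zy]; split.
- apply: Ar; split=> // i j; rewrite !mxE.
  by apply: le_ball (zy _ _); rewrite ge_min lexx.
- apply: Br; split=> // i j; rewrite !mxE.
  by apply: le_ball (zy _ _); rewrite ge_min lexx orbT.
Qed.

Definition cart (R : realType) (m n : nat) (A : openset R m) (B : openset R n) :
    openset R (m + n) :=
  OpenSet (open_cart_set (oset_open A) (oset_open B)).

Definition whole (R : realType) (n : nat) : openset R n := OpenSet openT.

Definition compact_in (R : realType) (d : nat) (O : set 'rV[R]_d) : Type :=
  {K : set 'rV[R]_d | compact K /\ K `<=` O}.

Section SmoothSpace.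
Variables (R : realType) (d : nat) (O : openset R d).

Definition sup_deriv (K : set 'rV[R]_d) (a : multi d) (f : 'rV[R]_d -> R[i]) :
    \bar R :=
  ereal_sup [set (normc (mderiv a f x))%:E | x in K].

Definition smooth_pred : pred ('rV[R]_d -> R[i]) := fun f => `[< smooth O f >].

Fact smooth_submod : submod_closed smooth_pred.
Proof.
split; first by apply/asboolP; exact: smooth0.
move=> c f g /asboolP sf /asboolP sg; apply/asboolP.
exact: (smooth_lin (oset_open O)).
Qed.

HB.instance Definition _ := GRing.isSubmodClosed.Build R[i]
  ('rV[R]_d -> R[i]) smooth_pred smooth_submod.

Record cinf := Cinf {
  cinf_fun :> 'rV[R]_d -> R[i];
  cinf_smooth : cinf_fun \in smooth_pred }.

HB.instance Definition _ := [isSub for cinf_fun].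
HB.instance Definition _ := [Choice of cinf by <:].
HB.instance Definition _ := [SubChoice_isSubLmodule of cinf by <:].

Definition cinf_sn (j : compact_in O * multi d) (f : cinf) : \bar R :=
  sup_deriv (sval j.1) j.2 f.

Fact cinf_sn0 j : (cinf_sn j 0%R <= 0)%E.
Proof.
apply: ge_ereal_sup => _ [x Kx <-].
by rewrite /mderiv partials0 normc0.
Qed.

Fact cinf_snD j f g : (cinf_sn j (f + g)%R <= cinf_sn j f + cinf_sn j g)%E.
Proof.
apply: ge_ereal_sup => _ [x Kx <-].
have Ox : oset O x by apply: (svalP j.1).2.
have /asboolP sf := cinf_smooth f; have /asboolP sg := cinf_smooth g.
have := partials_lin (oset_open O) 1 sf sg
  (flatten [seq nseq (j.2 i) i | i <- enum 'I_d]) Ox.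
rewrite scale1r mul1r /mderiv => ->.
apply: (@le_trans _ _ ((normc (mderiv j.2 f x))%:E + (normc (mderiv j.2 g x))%:E)%E).
  by rewrite -EFinD lee_fin le_normcD.
by apply: leeD; apply: ereal_sup_ubound; exists x.
Qed.

Fact cinf_snZ j (c : R[i]) f : (cinf_sn j (c *: f)%R <= (normc c)%:E * cinf_sn j f)%E.
Proof.
apply: ge_ereal_sup => _ [x Kx <-].
have Ox : oset O x by apply: (svalP j.1).2.
have /asboolP sf := cinf_smooth f.
have := partials_lin (oset_open O) c sf (@smooth0 _ _ O)
  (flatten [seq nseq (j.2 i) i | i <- enum 'I_d]) Ox.
rewrite addr0 partials0 fctE addr0 /mderiv => ->.
rewrite normcM EFinM lee_wpmul2l ?lee_fin ?normc_ge0//.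
by apply: ereal_sup_ubound; exists x.
Qed.

(* Elements of [cinf O] are total functions that are smooth on O; two of them
   that coincide on O are at distance 0 for all the seminorms, hence values
   outside of O become irrelevant in [calG O]. *)
Definition cinf_space : snspace R := SNSpace cinf_sn0 cinf_snD cinf_snZ.

Definition calG : Type := colombeau cinf_space.

HB.instance Definition _ := Choice.on calG.
HB.instance Definition _ := GRing.Lmodule.on calG.

End SmoothSpace.

Section SymbolSpace.
Variables (R : realType) (d n : nat) (O : openset R d).

Definition japanese (xi : 'rV[R]_n) : R :=
  Num.sqrt (1 + \sum_(i < n) xi 0 i ^+ 2).

(* The multi-index of D_xi^a D_z^b, for variables (z, xi) in R^(d + n). *)
Definition multi_cat (b : multi d) (a : multi n) : multi (d + n) :=
  [ffun i => match fintype.split i with inl j => b j | inr k => a k end].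

Definition symbol_sn (m : R) (K : set 'rV[R]_d) (a : multi n) (b : multi d)
    (f : 'rV[R]_(d + n) -> R[i]) : \bar R :=
  ereal_sup [set (japanese p.2 `^ (- m + (mdeg a)%:R) *
                  normc (mderiv (multi_cat b a) f (row_mx p.1 p.2)))%:E
            | p in K `*` [set: 'rV[R]_n]].

Definition symbol_idx : Type := R * compact_in O * multi n * multi d.

Definition symbol_idx_sn (j : symbol_idx) (f : 'rV[R]_(d + n) -> R[i]) : \bar R :=
  symbol_sn j.1.1.1 (sval j.1.1.2) j.1.2 j.2 f.

Definition is_symbol (f : 'rV[R]_(d + n) -> R[i]) : Prop :=
  smooth (cart O (whole R n)) f /\
  forall j : symbol_idx, (symbol_idx_sn j f < +oo)%E.

Fact symbol_sn0 j : (symbol_idx_sn j 0%R <= 0)%E.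
Proof.
apply: ge_ereal_sup => _ [x Kx <-].
by rewrite /mderiv partials0 normc0 mulr0.
Qed.

Fact symbol_snD j f g :
  smooth (cart O (whole R n)) f -> smooth (cart O (whole R n)) g ->
  (symbol_idx_sn j (f + g)%R <= symbol_idx_sn j f + symbol_idx_sn j g)%E.
Proof.
move=> sf sg; apply: ge_ereal_sup => _ [p Kp <-].
have Op : oset (cart O (whole R n)) (row_mx p.1 p.2).
  by split=> //=; rewrite row_mxKl; apply: (svalP j.1.1.2).2; case: Kp.
have := partials_lin (oset_open (cart O (whole R n))) 1 sf sg
  (flatten [seq nseq (multi_cat j.2 j.1.2 i) i | i <- enum 'I_(d + n)]) Op.
rewrite scale1r mul1r /mderiv => ->.
set w := _ `^ _.
apply: (@le_trans _ _ (
   (w * normc (mderiv (multi_cat j.2 j.1.2) f (row_mx p.1 p.2)))%:E +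
   (w * normc (mderiv (multi_cat j.2 j.1.2) g (row_mx p.1 p.2)))%:E)%E).
  by rewrite -EFinD lee_fin -mulrDr ler_wpM2l ?powR_ge0// le_normcD.
by apply: leeD; apply: ereal_sup_ubound; exists p.
Qed.

Fact symbol_snZ j (c : R[i]) f : smooth (cart O (whole R n)) f ->
  (symbol_idx_sn j (c *: f)%R <= (normc c)%:E * symbol_idx_sn j f)%E.
Proof.
move=> sf; apply: ge_ereal_sup => _ [p Kp <-].
have Op : oset (cart O (whole R n)) (row_mx p.1 p.2).
  by split=> //=; rewrite row_mxKl; apply: (svalP j.1.1.2).2; case: Kp.
have := partials_lin (oset_open (cart O (whole R n))) c sf (@smooth0 _ _ _)
  (flatten [seq nseq (multi_cat j.2 j.1.2 i) i | i <- enum 'I_(d + n)]) Op.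
rewrite addr0 partials0 fctE addr0 /mderiv => ->.
rewrite normcM mulrCA EFinM lee_wpmul2l ?lee_fin ?normc_ge0//.
by apply: ereal_sup_ubound; exists p.
Qed.

Definition symbol_pred : pred ('rV[R]_(d + n) -> R[i]) :=
  fun f => `[< is_symbol f >].

Fact symbol_submod : submod_closed symbol_pred.
Proof.
split.
  apply/asboolP; split; first exact: smooth0.
  by move=> j; apply: le_lt_trans (symbol_sn0 j) _; rewrite ltry.
move=> c f g /asboolP[sf fj] /asboolP[sg gj]; apply/asboolP; split.
  exact: (smooth_lin (oset_open _)).
move=> j; have scf : smooth (cart O (whole R n)) (c *: f).
  rewrite -[c *: f]addr0; apply: (smooth_lin (oset_open _)) => //.
  exact: smooth0.
apply: le_lt_trans (symbol_snD j scf sg) _; rewrite lte_add_pinfty//.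
apply: le_lt_trans (symbol_snZ j c sf) _.
by rewrite lte_mul_pinfty ?lee_fin ?normc_ge0.
Qed.

HB.instance Definition _ := GRing.isSubmodClosed.Build R[i]
  ('rV[R]_(d + n) -> R[i]) symbol_pred symbol_submod.

Record symbol := Symbol {
  symbol_fun :> 'rV[R]_(d + n) -> R[i];
  symbol_is_symbol : symbol_fun \in symbol_pred }.

HB.instance Definition _ := [isSub for symbol_fun].
HB.instance Definition _ := [Choice of symbol by <:].
HB.instance Definition _ := [SubChoice_isSubLmodule of symbol by <:].

Let sn (j : symbol_idx) (f : symbol) : \bar R := symbol_idx_sn j f.

Fact symbol_space_snD j (f g : symbol) : (sn j (f + g)%R <= sn j f + sn j g)%E.
Proof.
have /asboolP[sf _] := symbol_is_symbol f.
have /asboolP[sg _] := symbol_is_symbol g.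
exact: symbol_snD.
Qed.

Fact symbol_space_snZ j (c : R[i]) (f : symbol) :
  (sn j (c *: f)%R <= (normc c)%:E * sn j f)%E.
Proof.
by have /asboolP[sf _] := symbol_is_symbol f; exact: symbol_snZ.
Qed.

Definition symbol_space : snspace R :=
  @SNSpace R symbol symbol_idx sn symbol_sn0 symbol_space_snD symbol_space_snZ.

Definition gen_symbol : Type := colombeau symbol_space.

End SymbolSpace.

Section Supports.
Variables (R : realType) (d : nat) (O : openset R d).
Implicit Types (u v : calG O) (V : set 'rV[R]_d).

(* The restriction of [u] to the open subset [V] of [O] is 0 in [G(V)]. *)
Definition vanishes_on u V : Prop :=
  exists2 ue : modnet (cinf_space O), class_of ue = u &
    forall K : set 'rV[R]_d, compact K -> K `<=` V -> forall (a : multi d) (q : nat),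
      epsO (fun e => sup_deriv K a (ue e)) (fun e => val e ^+ q).

Definition null_opens u : set (set 'rV[R]_d) :=
  [set V | [/\ open V, V `<=` O & vanishes_on u V]].

(* The complement in O of the largest open set on which [u] vanishes. *)
Definition supp u : set 'rV[R]_d := oset O `\` \bigcup_(V in null_opens u) V.

Lemma vanishes_lin (c : Ctilde R) u v V W : V `<=` O ->
  vanishes_on u V -> vanishes_on v W -> vanishes_on (c *: u + v) (V `&` W).
Proof.
move=> VO [ue <- nu] [ve <- nv]; set ce := repr c.
have /moderatecP mc := modcnet_moderate ce.
exists (modnet_scale ce ue + ve).
  by rewrite class_ofD -colombeau_scaleE classc_ofK.
move=> K cK KVW a q.
have KO : K `<=` O by move=> x /KVW[/VO].
pose j : compact_in O * multi d := (exist _ K (conj cK KO), a).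
have nuK := nu K cK (fun x Kx => (KVW x Kx).1) a.
have nvK := nv K cK (fun x Kx => (KVW x Kx).2) a.
apply: epsO_le (epsO_D (epsO_negligibleMl (fun e => normc_ge0 (ce e)) mc nuK q)
  (nvK q)) => e.
apply: (le_trans (@snD_le R (cinf_space O) j (ce e *: ue e) (ve e))).
by apply: leeD => //; exact: (@snZ_le R (cinf_space O) j).
Qed.

Lemma supp_lin (c : Ctilde R) u v : supp (c *: u + v) `<=` supp u `|` supp v.
Proof.
move=> x [Ox nx]; apply: contrapT => /not_orP[nu nv]; apply: nx.
have [V [oV VO Vu] Vx] : (\bigcup_(V in null_opens u) V) x.
  by apply: contrapT => n; apply: nu.
have [W [oW WO Wv] Wx] : (\bigcup_(V in null_opens v) V) x.
  by apply: contrapT => n; apply: nv.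
exists (V `&` W) => //; split; first exact: openI.
  by move=> y [/VO].
exact: vanishes_lin.
Qed.

Lemma supp0 : supp 0 = set0.
Proof.
apply/seteqP; split=> // x [Ox]; apply.
exists (oset O) => //; split => //; first exact: oset_open.
exists 0; first by rewrite /class_of !piE.
move=> K cK KO a q; pose j : compact_in O * multi d := (exist _ K (conj cK KO), a).
exact: (@negligible0 _ (cinf_space O) j q).
Qed.

Lemma open_null_opens u : open (\bigcup_(V in null_opens u) V).
Proof. by apply: bigcup_open => V []. Qed.

Definition Gc_pred : pred (calG O) := fun u => `[< compact (supp u) >].

Fact Gc_submod : submod_closed Gc_pred.
Proof.
split; first by apply/asboolP; rewrite supp0; exact: compact0.
move=> c u v /asboolP cu /asboolP cv; apply/asboolP.
have -> : supp (c *: u + v) = (supp u `|` supp v) `&`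
    ~` \bigcup_(V in null_opens (c *: u + v)) V.
  apply/seteqP; split=> x.
    by move=> sx; split; [exact: supp_lin sx|case: sx].
  by move=> [[[Ox _]|[Ox _]] nx].
apply: compact_closedI; first exact: compactU.
by apply: open_closedC; exact: open_null_opens.
Qed.

HB.instance Definition _ := GRing.isSubmodClosed.Build (Ctilde R) (calG O) Gc_pred
  Gc_submod.

Record calGc := GcElt {
  gc_val :> calG O;
  gc_compact : gc_val \in Gc_pred }.

HB.instance Definition _ := [isSub for gc_val].
HB.instance Definition _ := [Choice of calGc by <:].
HB.instance Definition _ := [SubChoice_isSubLmodule of calGc by <:].

(* [ue] is a representative of [u] whose members are all supported in one
   compact subset of [O]. *)
Definition compact_repr (u : calGc) (ue : modnet (cinf_space O)) : Prop :=
  class_of ue = gc_val u /\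
  exists K : set 'rV[R]_d, [/\ compact K, K `<=` O &
    forall e x, oset O x -> ~ K x -> ue e x = 0].

Definition calGinfty (u : calG O) : Prop :=
  exists2 ue : modnet (cinf_space O), class_of ue = u &
    forall K : set 'rV[R]_d, compact K -> K `<=` O -> exists N : nat, forall a : multi d,
      epsO (fun e => sup_deriv K a (ue e)) (fun e => val e ^- N).

(* [u] is the class of the net [w], of which only the values on [O] matter. *)
Definition is_class (w : eps R -> 'rV[R]_d -> R[i]) (u : calG O) : Prop :=
  exists2 ue : modnet (cinf_space O), class_of ue = u &
    forall e x, oset O x -> ue e x = w e x.

End Supports.

(* The representative may depend on [K]. *)
Definition symbol_rg (R : realType) (d n : nat) (O : openset R d)
    (a : gen_symbol n O) : Prop :=
  forall K : set 'rV[R]_d, compact K -> K `<=` O ->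
    exists2 ae : modnet (symbol_space n O), class_of ae = a &
    exists N : nat, forall (m : R) (al : multi n) (be : multi d),
      epsO (fun e => symbol_sn m K al be (ae e)) (fun e => val e ^- N).

Section LebesgueTuple.
Variable R : realType.
Local Notation T := (measurableTypeR R).

Definition tcons (n : nat) (p : T * n.-tuple T) : n.+1.-tuple T :=
  [tuple of p.1 :: p.2].

Fact measurable_tcons n : measurable_fun setT (@tcons n).
Proof. exact: measurable_cons measurable_fst measurable_snd. Qed.

Section Step.
Variables (n : nat) (mu : {sigma_finite_measure set (n.-tuple T) -> \bar R}).

Definition leb_step : set (n.+1.-tuple T) -> \bar R :=
  pushforward (@lebesgue_measure R \x mu)%E (@tcons n).

Let m1 : {measure set (T * n.-tuple T) -> \bar R} := (@lebesgue_measure R \x mu)%E.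

Let mpre (A : set (n.+1.-tuple T)) : measurable A -> measurable (@tcons n @^-1` A).
Proof. by move=> mA; rewrite -[X in measurable X]setTI; exact: measurable_tcons. Qed.

Let leb_step0 : leb_step set0 = 0%E.
Proof. by rewrite /leb_step /pushforward preimage_set0 (measure0 m1). Qed.

Let leb_step_ge0 A : (0 <= leb_step A)%E.
Proof. exact: (measure_ge0 m1). Qed.

Let leb_step_sigma_additive : semi_sigma_additive leb_step.
Proof.
move=> F mF tF mUF; rewrite /leb_step /pushforward preimage_bigcup.
apply: (@measure_semi_sigma_additive _ _ _ m1).
- by move=> i; exact: mpre.
- apply/trivIsetP => /= i j _ _ ij; rewrite -preimage_setI.
  by move/trivIsetP : tF => /(_ _ _ _ _ ij) ->//; rewrite preimage_set0.
- by rewrite -preimage_bigcup; exact: mpre.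
Qed.

HB.instance Definition _ := isMeasure.Build _ _ _ leb_step
  leb_step0 leb_step_ge0 leb_step_sigma_additive.

Let tuncons (t : n.+1.-tuple T) : T * n.-tuple T := (thead t, [tuple of behead t]).

Let tconsK : cancel (@tcons n) tuncons.
Proof. by move=> [a t]; congr pair; apply: val_inj. Qed.

Let measurable_tuncons : measurable_fun setT tuncons.
Proof.
apply/measurable_fun_pairP; split; first exact: measurable_tnth.
exact: measurable_behead.
Qed.

Let leb_step_sigma_finite : sigma_finite setT leb_step.
Proof.
have /sigma_finiteP[F [TF ndF Foo]] := sigma_finiteT (@lebesgue_measure R).
have /sigma_finiteP[H [TH ndH Hoo]] := sigma_finiteT mu.
exists (fun i => tuncons @^-1` (F i `*` H i)).
  apply/seteqP; split=> // t _.
  have [i _ Fi] : (\bigcup_i F i) (thead t) by rewrite -TF.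
  have [k _ Hk] : (\bigcup_i H i) [tuple of behead t] by rewrite -TH.
  exists (maxn i k) => //; split=> /=.
  - by move: Fi; exact/subsetPset/ndF/leq_maxl.
  - by move: Hk; exact/subsetPset/ndH/leq_maxr.
move=> i; have [mFi Fi] := Foo i; have [mHi Hi] := Hoo i; split.
  rewrite -[X in measurable X]setTI; apply: measurable_tuncons => //.
  exact: measurableX.
rewrite /leb_step /pushforward -comp_preimage.
rewrite (_ : tuncons \o _ = id); last by apply/funext; exact: tconsK.
by rewrite preimage_id product_measure1E// lte_mul_pinfty// ge0_fin_numE.
Qed.

HB.instance Definition _ := Measure_isSigmaFinite.Build _ _ _ leb_step
  leb_step_sigma_finite.

End Step.

(* Lebesgue measure on R^n, carried by n-tuples, which have a measurable structure
   while row vectors have none; [trow] below converts. *)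
Fixpoint leb (n : nat) : {sigma_finite_measure set (n.-tuple T) -> \bar R} :=
  match n with
  | 0 => dirac ([tuple] : 0.-tuple T)
  | n'.+1 => leb_step (leb n')
  end.

End LebesgueTuple.

Definition Cintegral (R : realType) (disp : measure_display)
    (T : measurableType disp) (mu : {measure set T -> \bar R}) (D : set T)
    (f : T -> R[i]) : R[i] :=
  Rintegral mu D (fun t => complex.Re (f t)) +i*
  Rintegral mu D (fun t => complex.Im (f t)).

Section Operators.
Variables (R : realType) (n : nat).
Local Notation T := (measurableTypeR R).

Definition trow (t : n.-tuple T) : 'rV[R]_n := \row_i tnth t i.

Definition dot (x y : 'rV[R]_n) : R := \sum_(i < n) x 0 i * y 0 i.

Definition expi (t : R) : R[i] := cos t +i* sin t.

Definition kernel_integral (O : set 'rV[R]_n) (k : 'rV[R]_(n + n) -> R[i])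
    (u : 'rV[R]_n -> R[i]) : 'rV[R]_n -> R[i] :=
  fun x => Cintegral (leb R n) [set t | O (trow t)]
    (fun t => k (row_mx x (trow t)) * u (trow t)).

Definition pdo_integral (O : set 'rV[R]_n) (a : 'rV[R]_((n + n) + n) -> R[i])
    (u : 'rV[R]_n -> R[i]) : 'rV[R]_n -> R[i] :=
  fun x => ((2 * pi) ^- n)%:C *
    Cintegral (leb R n \x leb R n)%E [set p | O (trow p.1)]
      (fun p => let y := trow p.1 in let xi := trow p.2 in
        expi (dot (x - y) xi) * a (row_mx (row_mx x y) xi) * u y).

Variable O : openset R n.

(* The integral does not depend on the representatives, so the choice between
   some and all representatives [ke] is immaterial here and for [ae] below. *)
Definition has_kernel (A : calGc O -> calG O) (k : calG (cart O O)) : Prop :=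
  exists2 ke : modnet (cinf_space (cart O O)), class_of ke = k &
    forall (u : calGc O) (ue : modnet (cinf_space O)), compact_repr u ue ->
      is_class (fun e => kernel_integral O (ke e) (ue e)) (A u).

Definition has_amplitude (A : calGc O -> calG O) (a : gen_symbol n (cart O O)) : Prop :=
  exists2 ae : modnet (symbol_space n (cart O O)), class_of ae = a &
    forall (u : calGc O) (ue : modnet (cinf_space O)), compact_repr u ue ->
      is_class (fun e => pdo_integral O (ae e) (ue e)) (A u).

Definition generalized_kernel_operator (A : calGc O -> calG O) : Prop :=
  exists k : calG (cart O O), has_kernel A k.

Definition regular_kernel_operator (A : calGc O -> calG O) : Prop :=
  exists2 k : calG (cart O O), calGinfty k & has_kernel A k.

Definition smoothing_pdo (A : calGc O -> calG O) : Prop :=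
  exists a : gen_symbol n (cart O O), has_amplitude A a.

Definition regular_smoothing_pdo (A : calGc O -> calG O) : Prop :=
  exists2 a : gen_symbol n (cart O O), symbol_rg a & has_amplitude A a.

End Operators.

(* Main.v *)
Require Import Defs.
From mathcomp Require Import all_boot all_order all_algebra.
From mathcomp Require Import all_classical all_reals all_analysis.
From mathcomp Require Import complex measurable_realfun.
From mathcomp Require Import ring lra.

(** Write [phase] for (x - y) . xi. By Fubini, the pseudodifferential operator
    with an amplitude a of order -oo is the integral operator with kernel

      k(x, y) = (2 pi)^-n \int e^(i (x - y) . xi) a(x, y, xi) dxi,

    [amplitude_kernel a] below ([amplitude_kernel_pdo]). Going back needs no
    Fourier inversion: multiplying a kernel k by e^(-i (x - y) . xi) and by a
    Gaussian in xi of total mass (2 pi)^n gives an amplitude,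
    [kernel_amplitude k], whose oscillating factor cancels the one in the formula
    above, so that its kernel is k again ([kernel_amplitudeK]). Hence the operator
    with kernel k is also the operator with amplitude [kernel_amplitude k], for
    every single eps and every test function.

    It remains to see that both maps, applied to each member of a net, send
    moderate nets to moderate nets, negligible nets to negligible nets and regular
    nets to regular nets. Both are linear, and a seminorm of the image on a
    compact set K is bounded by a constant times finitely many seminorms of the
    argument on the same K. Keeping K is what makes the regular case work: a
    regular symbol may have a different good representative for each K.

    The estimates rest on the Leibniz rule in the form [partials_expM]: a
    derivative of e^q h with q a polynomial is e^q times an operator with
    polynomial coefficients applied to h, the operator being independent of h and
    therefore of eps. Polynomials cost powers of the Japanese bracket of xi only,
    which are absorbed by the rapid decay of a symbol or of the Gaussian. A kernel
    is differentiated under the integral sign, with the integrable weight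
    \prod_i (1 + xi_i^2)^-1 as a dominating function. As smoothness concerns
    derivatives in any order while the seminorms only see those taken in increasing
    order of the variables, the symmetry of second derivatives is needed as well
    ([partials_mderiv]). *)

Set Implicit Arguments.
Unset Strict Implicit.
Unset Printing Implicit Defensive.

Import Order.TTheory GRing.Theory Num.Theory numFieldNormedType.Exports.
Import Normc.

Local Open Scope classical_set_scope.
Local Open Scope ring_scope.
Local Open Scope complex_scope.

(** * Partial derivatives of complex-valued functions *)

Section Calculus.
Variables (R : realType) (d : nat).
Implicit Types (f g : 'rV[R]_d -> R[i]) (x : 'rV[R]_d) (i : 'I_d)
  (s t : seq 'I_d) (U : set 'rV[R]_d).

(** Unlike [partial], which takes a default value where the limit does not
    exist, this asserts the existence of the derivative. *)
Definition has_partial i f x (l : R[i]) : Prop :=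
  is_derive x (basis_vec R i) (re_fun f) (complex.Re l) /\
  is_derive x (basis_vec R i) (im_fun f) (complex.Im l).

Definition ccont f x : Prop :=
  {for x, continuous (re_fun f)} /\ {for x, continuous (im_fun f)}.

Lemma has_partial_val i f x l : has_partial i f x l -> partial i f x = l.
Proof.
by move=> [dr di]; rewrite /partial !derive_val; case: l {dr di}.
Qed.

Lemma has_partial_eq i f x l l' : l = l' -> has_partial i f x l ->
  has_partial i f x l'.
Proof. by move=> ->. Qed.

Lemma smoothP U f : smooth U f <-> forall s x, U x ->
  ccont (partials s f) x /\
  forall i, has_partial i (partials s f) x (partials (i :: s) f x).
Proof.
split=> [sf s x Ux|H s x Ux].
  have [cr ci di] := sf s x Ux; split=> // i.
  by have [dr dii] := di i; split; exact: derivableP.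
have [[cr ci] di] := H s x Ux; split=> // i.
by have [[dr _] [dii _]] := di i.
Qed.

Lemma smooth_ccont U f s x : smooth U f -> U x -> ccont (partials s f) x.
Proof. by move=> /smoothP /(_ s x) /[apply] -[]. Qed.

Lemma smooth_has_partial U f s x i : smooth U f -> U x ->
  has_partial i (partials s f) x (partials (i :: s) f x).
Proof. by move=> /smoothP /(_ s x) /[apply] -[_]. Qed.

Lemma near_has_partial i f g x l : (\forall y \near x, f y = g y) ->
  has_partial i f x l -> has_partial i g x l.
Proof.
move=> fg [dr di]; split.
  by apply: near_eq_is_derive dr; apply: filterS fg => y; rewrite /re_fun => ->.
by apply: near_eq_is_derive di; apply: filterS fg => y; rewrite /im_fun => ->.
Qed.

Lemma near_continuous_for (a b : 'rV[R]_d -> R) x :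
  (\forall y \near x, a y = b y) ->
  {for x, continuous a} -> {for x, continuous b}.
Proof.
rewrite /prop_for /continuous_at => hk hx.
rewrite -(nbhs_singleton hk); apply: cvg_trans hx.
exact: (@near_eq_cvg _ _ (nbhs x) _ a b hk).
Qed.

Lemma near_ccont f g x : (\forall y \near x, f y = g y) -> ccont f x -> ccont g x.
Proof.
move=> fg [cr ci]; split.
  by apply: near_continuous_for cr; apply: filterS fg => y; rewrite /re_fun => ->.
by apply: near_continuous_for ci; apply: filterS fg => y; rewrite /im_fun => ->.
Qed.

(** Smoothness follows once every iterated derivative is known in closed form
    on the open set U: near a point of U the closed form can be differentiated in
    its place. *)
Lemma smooth_of_partials U f : open U ->
  (forall s, exists2 g, forall x, U x -> partials s f x = g x &
    forall x, U x -> ccont g x /\ forall i, exists l, has_partial i g x l) ->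
  smooth U f.
Proof.
move=> oU H; apply/smoothP => s x Ux.
have [g fg gd] := H s; have [cg pg] := gd x Ux.
have gf : \forall y \near x, g y = partials s f y.
  by apply: near_open Ux _ => // y /fg.
split=> [|i]; first exact: near_ccont gf cg.
have [l hl] := pg i; have := near_has_partial gf hl => fl.
by rewrite /= (has_partial_val fl).
Qed.

Lemma re_funM f g :
  re_fun (f * g) = re_fun f * re_fun g - im_fun f * im_fun g.
Proof.
apply/funext => x; rewrite /re_fun /im_fun !fctE.
by case: (f x) (g x) => [a b] [a' b'].
Qed.

Lemma im_funM f g :
  im_fun (f * g) = re_fun f * im_fun g + im_fun f * re_fun g.
Proof.
apply/funext => x; rewrite /re_fun /im_fun !fctE.
by case: (f x) (g x) => [a b] [a' b'].
Qed.

Lemma re_funD f g : re_fun (f + g) = re_fun f + re_fun g.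
Proof.
by apply/funext => x; rewrite /re_fun !fctE; case: (f x) (g x) => [a b] [a' b'].
Qed.

Lemma im_funD f g : im_fun (f + g) = im_fun f + im_fun g.
Proof.
by apply/funext => x; rewrite /im_fun !fctE; case: (f x) (g x) => [a b] [a' b'].
Qed.

Lemma has_partial_cst i (c : R[i]) x : has_partial i (fun=> c) x 0.
Proof. by split; exact: is_derive_cst. Qed.

Lemma has_partialD i f g x l m : has_partial i f x l -> has_partial i g x m ->
  has_partial i (fun y => f y + g y) x (l + m).
Proof.
move=> [fr fi] [gr gi]; rewrite /has_partial.
have -> : re_fun (fun y => f y + g y) = re_fun f + re_fun g by rewrite -re_funD.
have -> : im_fun (fun y => f y + g y) = im_fun f + im_fun g by rewrite -im_funD.
have -> : complex.Re (l + m) = complex.Re l + complex.Re m.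
  by case: l m {fr fi gr gi} => [a b] [a' b'].
have -> : complex.Im (l + m) = complex.Im l + complex.Im m.
  by case: l m {fr fi gr gi} => [a b] [a' b'].
by split; exact: is_deriveD.
Qed.

Lemma has_partialM i f g x l m : has_partial i f x l -> has_partial i g x m ->
  has_partial i (fun y => f y * g y) x (l * g x + f x * m).
Proof.
move=> [fr fi] [gr gi]; rewrite /has_partial.
have -> : (fun y => f y * g y) = f * g by [].
rewrite re_funM im_funM; split.
- apply: is_derive_eq; rewrite /GRing.scale /= /re_fun /im_fun.
  case: l m (f x) (g x) {fr fi gr gi} => [a b] [a' b'] [p q] [p' q'] /=; ring.
- apply: is_derive_eq; rewrite /GRing.scale /= /re_fun /im_fun.
  case: l m (f x) (g x) {fr fi gr gi} => [a b] [a' b'] [p q] [p' q'] /=; ring.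
Qed.

Lemma ccont_cst (c : R[i]) x : ccont (fun=> c) x.
Proof. by split; exact: cst_continuous. Qed.

Lemma ccontD f g x : ccont f x -> ccont g x -> ccont (fun y => f y + g y) x.
Proof.
move=> [fr fi] [gr gi]; rewrite /ccont.
have -> : re_fun (fun y => f y + g y) = re_fun f + re_fun g by rewrite -re_funD.
have -> : im_fun (fun y => f y + g y) = im_fun f + im_fun g by rewrite -im_funD.
by split; exact: continuousD.
Qed.

Lemma ccontM f g x : ccont f x -> ccont g x -> ccont (fun y => f y * g y) x.
Proof.
move=> [fr fi] [gr gi]; rewrite /ccont.
have -> : (fun y => f y * g y) = f * g by [].
rewrite re_funM im_funM.
have M (a b : 'rV[R]_d -> R) : {for x, continuous a} -> {for x, continuous b} ->
  {for x, continuous (a * b)} by move=> ca cb; exact: continuousM.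
by split; [apply: (continuousB (M _ _ fr gr) (M _ _ fi gi))|
           apply: (continuousD (M _ _ fr gi) (M _ _ fi gr))].
Qed.

(** A directional derivative is a derivative at 0 along a line; this gives
    access to the chain rule and the mean value theorem in one variable. *)
Lemma is_derive_line (u : 'rV[R]_d -> R) x v (l : R) :
  is_derive x v u l <-> is_derive (0 : R) 1 (fun h : R => u (h *: v + x)) l.
Proof.
have E : 'D_v u x = 'D_1 (fun h : R => u (h *: v + x)) (0 : R).
  rewrite /derive; set p := fun _ => _; set q := fun _ => _.
  suff -> : p = q by [].
  by apply/funext => h; rewrite /p /q /= addr0 scale0r add0r [_%:A]mulr1.
split=> -[D V].
  by apply: DeriveDef; [exact: (derivable1P u x v).1|rewrite -E].
by apply: DeriveDef; [exact: (derivable1P u x v).2|rewrite E].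
Qed.

Lemma is_derive_comp1 (phi : R -> R) (u : 'rV[R]_d -> R) x v (l m : R) :
  is_derive x v u l -> is_derive (u x) 1 phi m ->
  is_derive x v (phi \o u) (m * l).
Proof.
move=> /is_derive_line du dp; apply/is_derive_line.
have dp' : is_derive (u (0 *: v + x)) 1 phi m by rewrite scale0r add0r.
exact: (@is_derive1_comp R phi (fun h => u (h *: v + x)) 0).
Qed.

Lemma is_derive_coord i x (j : 'I_d) :
  is_derive x (basis_vec R i) (fun y : 'rV[R]_d => y 0 j) ((j == i)%:R).
Proof.
apply/is_derive_line.
set c : R := (j == i)%:R.
have -> : (fun h : R => (h *: basis_vec R i + x) 0 j) =
   (c \*: (id : R -> R)) + cst (x 0 j).
  by apply/funext => h; rewrite /c !fctE !mxE eqxx /= mulrC.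
by apply: is_derive_eq; rewrite addr0 /GRing.scale /= mulr1.
Qed.

End Calculus.

(** * Differential operators with polynomial coefficients *)

Section PolynomialOperators.
Variables (R : realType) (d : nat).
Implicit Types (u v : 'rV[R]_d -> R) (f g : 'rV[R]_d -> R[i])
  (x : 'rV[R]_d) (i : 'I_d) (s t : seq 'I_d) (U : set 'rV[R]_d).

(** Polynomial functions, described by closure: stability under derivation and
    polynomial growth are both inductions on this description. *)
Inductive rpoly : ('rV[R]_d -> R) -> Prop :=
| rpoly_cst (c : R) : rpoly (cst c)
| rpoly_coord (j : 'I_d) : rpoly (fun x => x 0 j)
| rpolyD u v : rpoly u -> rpoly v -> rpoly (u + v)
| rpolyM u v : rpoly u -> rpoly v -> rpoly (u * v).

Lemma rpolyN u : rpoly u -> rpoly (- u).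
Proof.
move=> pu; have -> : - u = cst (-1) * u by apply/funext => x; rewrite !fctE mulN1r.
exact: rpolyM (rpoly_cst _) pu.
Qed.

Lemma rpolyB u v : rpoly u -> rpoly v -> rpoly (u - v).
Proof. by move=> pu pv; apply: rpolyD pu (rpolyN pv). Qed.

Lemma rpoly_sum (I : Type) (r : seq I) (F : I -> 'rV[R]_d -> R) :
  (forall k, rpoly (F k)) -> rpoly (fun x => \sum_(k <- r) F k x).
Proof.
move=> pF; have -> : (fun x => \sum_(k <- r) F k x) = \sum_(k <- r) F k.
  by apply/funext => x; rewrite fct_sumE.
elim/big_ind : _ => //; [exact: rpoly_cst|exact: rpolyD].
Qed.

Lemma rpoly_cont u x : rpoly u -> {for x, continuous u}.
Proof.
elim=> [c|j|{}u v _ cu _ cv|{}u v _ cu _ cv].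
- exact: cst_continuous.
- exact: coord_continuous.
- exact: continuousD.
- exact: continuousM.
Qed.

Lemma rpoly_derive u i : rpoly u ->
  exists2 u', rpoly u' & forall x, is_derive x (basis_vec R i) u (u' x).
Proof.
elim=> [c|j|{}u v pu [u' pu' du] pv [v' pv' dv]|
  {}u v pu [u' pu' du] pv [v' pv' dv]].
- by exists (cst 0) => [|x]; [exact: rpoly_cst|exact: is_derive_cst].
- by exists (cst (j == i)%:R) => [|x]; [exact: rpoly_cst|exact: is_derive_coord].
- by exists (u' + v') => [|x]; [exact: rpolyD|exact: is_deriveD].
- exists (u * v' + v * u') => [|x]; last exact: is_deriveM.
  by apply: rpolyD; exact: rpolyM.
Qed.

Definition cpoly f : Prop := rpoly (re_fun f) /\ rpoly (im_fun f).

Lemma cpolyM f g : cpoly f -> cpoly g -> cpoly (f * g).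
Proof.
move=> [fr fi] [gr gi]; rewrite /cpoly re_funM im_funM; split.
  by apply: rpolyB; exact: rpolyM.
by apply: rpolyD; exact: rpolyM.
Qed.

Lemma cpoly_cst (c : R[i]) : cpoly (fun=> c).
Proof. by split; exact: rpoly_cst. Qed.

Lemma cpoly_ccont f x : cpoly f -> ccont f x.
Proof. by move=> [fr fi]; split; exact: rpoly_cont. Qed.

Lemma cpoly_partial f i : cpoly f ->
  exists2 f', cpoly f' & forall x, has_partial i f x (f' x).
Proof.
move=> [/(rpoly_derive i)[a pa da] /(rpoly_derive i)[b pb db]].
by exists (fun x => a x +i* b x) => [|x]; split.
Qed.

(** exp (a + i b). *)
Definition expc (a b : 'rV[R]_d -> R) : 'rV[R]_d -> R[i] :=
  fun x => (expR (a x) * cos (b x)) +i* (expR (a x) * sin (b x)).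

Lemma expc_ccont a b x : rpoly a -> rpoly b -> ccont (expc a b) x.
Proof.
move=> /rpoly_cont ca /rpoly_cont cb.
have ce : {for x, continuous (expR \o a)}.
  by apply: continuous_comp; [exact: ca|exact: continuous_expR].
split; apply: continuousM => //.
  by apply: continuous_comp; [exact: cb|exact: continuous_cos].
by apply: continuous_comp; [exact: cb|exact: continuous_sin].
Qed.

Lemma expc_partial a b i : rpoly a -> rpoly b ->
  exists2 L, cpoly L & forall x, has_partial i (expc a b) x (L x * expc a b x).
Proof.
move=> /(rpoly_derive i)[a' pa da] /(rpoly_derive i)[b' pb db].
exists (fun x => a' x +i* b' x) => [//|x].
have de := is_derive_comp1 (da x) (is_derive_expR (a x)).
have dc := is_derive_comp1 (db x) (is_derive_cos (b x)).
have ds := is_derive_comp1 (db x) (is_derive_sin (b x)).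
split.
  have := is_deriveM de dc; congr (is_derive _ _ _ _).
  rewrite /expc /= /GRing.scale /=; ring.
have := is_deriveM de ds; congr (is_derive _ _ _ _).
rewrite /expc /= /GRing.scale /=; ring.
Qed.

(** Finite sums of operators P d^t with P polynomial. Such an operator is fixed
    before the function it acts on, so that one operator serves all members of a
    net. *)
Inductive polyop : (('rV[R]_d -> R[i]) -> 'rV[R]_d -> R[i]) -> Prop :=
| polyop_term P t : cpoly P -> polyop (fun h x => P x * partials t h x)
| polyopD S T : polyop S -> polyop T -> polyop (fun h x => S h x + T h x).

Lemma polyop_ccont T U h x : polyop T -> smooth U h -> U x -> ccont (T h) x.
Proof.
move=> pT sh Ux; elim: pT => [P t pP|S {}T _ cS _ cT].
  by apply: ccontM; [exact: cpoly_ccont|exact: smooth_ccont sh Ux].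
exact: ccontD.
Qed.

Lemma polyop_mul L T : cpoly L -> polyop T ->
  exists2 T', polyop T' & forall h x, T' h x = L x * T h x.
Proof.
move=> pL; elim=> [P t pP|S {}T _ [S' pS' eS] _ [T' pT' eT]].
  exists (fun h x => (L * P) x * partials t h x).
    by apply: polyop_term; exact: cpolyM.
  by move=> h x; rewrite mulrA.
exists (fun h x => S' h x + T' h x) => [|h x]; first exact: polyopD.
by rewrite eS eT mulrDr.
Qed.

Lemma polyop_partial T i : polyop T -> exists2 T', polyop T' &
  forall U h x, smooth U h -> U x -> has_partial i (T h) x (T' h x).
Proof.
elim=> [P t pP|S {}T _ [S' pS' eS] _ [T' pT' eT]].
  have [P' pP' dP] := cpoly_partial i pP.
  exists (fun h x => P' x * partials t h x + P x * partials (i :: t) h x).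
    by apply: polyopD; exact: polyop_term.
  move=> U h x sh Ux; apply: has_partialM; first exact: dP.
  exact: smooth_has_partial sh Ux.
exists (fun h x => S' h x + T' h x) => [|U h x sh Ux]; first exact: polyopD.
by apply: has_partialD; [exact: eS sh Ux|exact: eT sh Ux].
Qed.

Variables a b : 'rV[R]_d -> R.
Hypotheses (pa : rpoly a) (pb : rpoly b).

(** Conjugating the derivation d_i by exp (a + i b) adds the polynomial
    d_i (a + i b) to it, so that conjugating a product of derivations gives an
    operator with polynomial coefficients. *)
Lemma partials_expM s : exists2 T, polyop T &
  forall U, open U -> forall h x, smooth U h -> U x ->
    partials s (fun y => expc a b y * h y) x = expc a b x * T h x.
Proof.
elim: s => [|i s [T pT eT]].
  exists (fun h x => 1 * partials [::] h x).
    by apply: polyop_term; exact: cpoly_cst.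
  by move=> U oU h x sh Ux /=; rewrite mul1r.
have [L pL dE] := expc_partial i pa pb.
have [T1 pT1 eT1] := polyop_mul pL pT.
have [T2 pT2 eT2] := polyop_partial i pT.
exists (fun h x => T1 h x + T2 h x); first exact: polyopD.
move=> U oU h x sh Ux /=; apply: has_partial_val.
apply: (@near_has_partial _ _ _ (fun y => expc a b y * T h y)).
  by apply: near_open Ux _ => // y Uy; rewrite (eT U).
apply: has_partial_eq (has_partialM (dE x) (eT2 _ _ _ sh Ux)).
by rewrite eT1; ring.
Qed.

Lemma smooth_expM U h : open U -> smooth U h ->
  smooth U (fun y => expc a b y * h y).
Proof.
move=> oU sh; apply: smooth_of_partials => // s.
have [T pT eT] := partials_expM s.
exists (fun x => expc a b x * T h x) => [x Ux|x Ux]; first exact: eT Ux.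
split; first by apply: ccontM; [exact: expc_ccont|exact: polyop_ccont sh Ux].
move=> i; have [L pL dE] := expc_partial i pa pb.
have [T2 pT2 eT2] := polyop_partial i pT.
by eexists; apply: has_partialM; [exact: dE|exact: eT2 sh Ux].
Qed.

End PolynomialOperators.

(** * Symmetry of mixed partial derivatives *)

Section RowNorm.
Variables (R : realType) (d : nat).
Implicit Type x : 'rV[R]_d.

Lemma rv_norm_le x c : 0 <= c -> (forall i, `|x 0 i| <= c) -> `|x| <= c.
Proof.
move=> c0 H; rewrite [`|x|]mx_normrE; apply/bigmax_leP; split=> // -[i j] _ /=.
by rewrite (ord1 i).
Qed.

Lemma rv_coord_le x i : `|x 0 i| <= `|x|.
Proof.
rewrite [leRHS]mx_normrE.
exact: (le_bigmax _ (fun ij : 'I_1 * 'I_d => `|x ij.1 ij.2|) (0, i)).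
Qed.

Lemma basis_vec_norm i : `|basis_vec R i : 'rV[R]_d| <= 1.
Proof.
apply: rv_norm_le => // j; rewrite /basis_vec mxE.
by case: (_ && _); rewrite ?normr1 ?normr0.
Qed.

End RowNorm.

Section Schwarz.
Variables (R : realType) (d : nat).
Implicit Types (u : 'rV[R]_d -> R) (f g : 'rV[R]_d -> R[i])
  (x y z v w : 'rV[R]_d) (i j : 'I_d) (s t : seq 'I_d) (U : set 'rV[R]_d).

Lemma is_derive_slice u z v (c l : R) : is_derive (c *: v + z) v u l ->
  is_derive c 1 (fun h : R => u (h *: v + z)) l.
Proof.
move=> /is_derive_line du.
have du' : is_derive (c - c) 1 (fun h : R => u (h *: v + (c *: v + z))) l.
  by rewrite subrr.
have ds : is_derive c (1 : R) (fun h : R => h - c) 1.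
  have : is_derive c (1 : R) ((id : R -> R) - cst c) (1 - 0).
    by apply: is_deriveB.
  by rewrite subr0.
have := @is_derive1_comp R _ (fun h : R => h - c) c l 1 du' ds.
rewrite mulr1; congr (is_derive _ _ _ _); apply/funext => h /=.
by rewrite addrA -scalerDl subrK.
Qed.

Lemma MVT_slice u (du : 'rV[R]_d -> R) z v (h : R) : 0 < h ->
  (forall c, 0 <= c <= h -> is_derive (c *: v + z) v u (du (c *: v + z))) ->
  exists2 c, 0 <= c <= h & u (h *: v + z) - u z = h * du (c *: v + z).
Proof.
move=> h0 H; pose F (k : R) := u (k *: v + z); pose G (k : R) := du (k *: v + z).
have dF (c : R) : c \in `]0, h[ -> is_derive c 1 F (G c).
  by rewrite in_itv /= => /andP[/ltW c0 /ltW ch]; apply/is_derive_slice/H; rewrite c0.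
have cF : {within `[0, h], continuous F}.
  apply: derivable_within_continuous => c; rewrite in_itv /= => hc.
  by have [] := is_derive_slice (H c hc).
have [c] := MVT h0 dF cF.
rewrite /F /G in_itv /= => /andP[/ltW c0 /ltW ch]; rewrite scale0r add0r subr0 mulrC.
by move=> e; exists c; rewrite ?c0.
Qed.

(** The mean value theorem along v, then along w: the second difference over a
    parallelogram is h^2 times a mixed derivative at some point of it. *)
Lemma mixed_difference u (du ddu : 'rV[R]_d -> R) z v w (h : R) : 0 < h ->
  (forall p q, 0 <= p <= h -> 0 <= q <= h ->
    is_derive (p *: v + (q *: w + z)) v u (du (p *: v + (q *: w + z))) /\
    is_derive (q *: w + (p *: v + z)) w du (ddu (q *: w + (p *: v + z)))) ->
  exists p q, [/\ 0 <= p <= h, 0 <= q <= h &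
   u (h *: v + (h *: w + z)) - u (h *: w + z) - (u (h *: v + z) - u z) =
   h * (h * ddu (q *: w + (p *: v + z)))].
Proof.
move=> h0 H; have hh : 0 <= h <= h by rewrite ltW // lexx.
have oo : 0 <= (0 : R) <= h by rewrite lexx ltW.
pose D y := u (y + h *: w) - u y; pose dD y := du (y + h *: w) - du y.
have dDP c : 0 <= c <= h -> is_derive (c *: v + z) v D (dD (c *: v + z)).
  move=> hc.
  have [d1 _] := H _ _ hc hh; have [d2 _] := H _ _ hc oo.
  rewrite scale0r add0r in d2.
  have d3 : is_derive (c *: v + z) v (fun y => u (y + h *: w))
      (du (c *: v + z + h *: w)).
    apply/is_derive_line; have /is_derive_line := d1.
    rewrite [h *: w + z]addrC addrA; congr (is_derive _ _ _ _).
    by apply/funext => k; rewrite addrA.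
  exact: is_deriveB.
have [p hp] := MVT_slice h0 dDP; rewrite /D /dD.
have -> : h *: v + z + h *: w = h *: v + (h *: w + z) by rewrite addrAC addrA.
have -> : z + h *: w = h *: w + z by rewrite addrC.
rewrite addrC => e.
have [q hq] := @MVT_slice du ddu (p *: v + z) w h h0
  (fun c hc => (H _ _ hp hc).2).
rewrite [_ + h *: w]addrC in e => e2.
exists p, q; split=> //; rewrite -e2 -e; ring.
Qed.

(** The second difference is symmetric in the two directions, so both mixed
    derivatives take a common value, each at some point as close to x as desired;
    continuity at x concludes. *)
Lemma schwarz_real u (ui uj uij uji : 'rV[R]_d -> R) U x i j :
  open U -> U x ->
  (forall y, U y -> is_derive y (basis_vec R i) u (ui y)) ->
  (forall y, U y -> is_derive y (basis_vec R j) u (uj y)) ->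
  (forall y, U y -> is_derive y (basis_vec R j) ui (uji y)) ->
  (forall y, U y -> is_derive y (basis_vec R i) uj (uij y)) ->
  {for x, continuous uij} -> {for x, continuous uji} ->
  uij x = uji x.
Proof.
move=> oU Ux dui duj duji duij cij cji.
set v := basis_vec R i; set w := basis_vec R j.
have nv : `|v| <= 1 := basis_vec_norm R i.
have nw : `|w| <= 1 := basis_vec_norm R j.
apply/eqP; rewrite -subr_eq0 -normr_le0; apply/ler_addgt0Pr => e e0.
rewrite add0r.
have e2 : 0 < e / 2 by rewrite divr_gt0.
have nU : nbhs x U by exact: open_nbhs_nbhs.
have := cij; move=> /cvgrPdist_le /(_ _ e2) nij.
have := cji; move=> /cvgrPdist_le /(_ _ e2) nji.
have [r /= r0 Br] := (@nbhs_ballP _ _ _ _).1 (filterI nU (filterI nij nji)).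
(* Then x + p v + q w stays in the ball of radius r for 0 <= p, q <= h. *)
pose h := r / 3.
have h0 : 0 < h by rewrite divr_gt0.
have inB p q : 0 <= p <= h -> 0 <= q <= h -> ball x r (p *: v + (q *: w + x)).
  move=> /andP[p0 ph] /andP[q0 qh].
  rewrite -ball_normE /= addrA [_ + x]addrC opprD addrA subrr add0r normrN.
  apply: (le_lt_trans (ler_normD _ _)); rewrite !normrZ !ger0_norm //.
  apply: (@le_lt_trans _ _ (h + h)).
    apply: lerD; first by rewrite -[leRHS]mulr1 ler_pM.
    by rewrite -[leRHS]mulr1 ler_pM.
  rewrite /h; lra.
have swap p q : q *: w + (p *: v + x) = p *: v + (q *: w + x).
  by rewrite addrCA.
have [p [q [hp hq E1]]] := @mixed_difference u ui uji x v w h h0 (fun p q hp hq =>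
  conj (dui _ (Br _ (inB _ _ hp hq)).1)
   (eq_ind_r (fun y => is_derive y w ui (uji y))
     (duji _ (Br _ (inB _ _ hp hq)).1) (swap p q))).
have [p' [q' [hp' hq' E2]]] := @mixed_difference u uj uij x w v h h0 (fun p q hp hq =>
  conj (eq_ind_r (fun y => is_derive y w u (uj y))
     (duj _ (Br _ (inB _ _ hq hp)).1) (swap q p))
   (duij _ (Br _ (inB _ _ hq hp)).1)).
have [_ [_ B1]] := Br _ (inB _ _ hp hq).
have [_ [B2 _]] := Br _ (inB _ _ hq' hp').
have E : uij (q' *: v + (p' *: w + x)) = uji (p *: v + (q *: w + x)).
  rewrite -(swap p q); have hn : h != 0 by rewrite gt_eqF.
  apply: (mulfI hn); apply: (mulfI hn).
  rewrite -E1 -E2 (swap h h); ring.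
have -> : uij x - uji x =
  (uij x - uij (q' *: v + (p' *: w + x))) - (uji x - uji (p *: v + (q *: w + x))).
  rewrite E; ring.
apply: (le_trans (ler_normB _ _)); rewrite [leRHS]splitr.
exact: lerD.
Qed.

Lemma partials_congr U f g : open U -> (forall x, U x -> f x = g x) ->
  forall s x, U x -> partials s f x = partials s g x.
Proof.
move=> oU fg; elim=> [|i s IH] x Ux /=; first exact: fg.
have E : \forall y \near x, partials s f y = partials s g y.
  by apply: near_open Ux _ => // y; exact: IH.
rewrite /partial; congr (_ +i* _); apply: near_eq_derive;
  by apply: filterS E => y; rewrite /re_fun /im_fun => ->.
Qed.

Lemma partials_cat s t f : partials (s ++ t) f = partials s (partials t f).
Proof. by rewrite /partials foldr_cat. Qed.

Lemma smooth_partials U f s : smooth U f -> smooth U (partials s f).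
Proof. by move=> sf t x Ux; rewrite -partials_cat; exact: sf. Qed.

Lemma partialsC U f i j x : open U -> smooth U f -> U x ->
  partials [:: i; j] f x = partials [:: j; i] f x.
Proof.
move=> oU sf Ux; have P s k y (Uy : U y) := smooth_has_partial s k sf Uy.
have [cr ci] := smooth_ccont [:: i; j] sf Ux.
have [cr' ci'] := smooth_ccont [:: j; i] sf Ux.
apply/eqP; rewrite eq_complex; apply/andP; split; apply/eqP.
- exact: (@schwarz_real (re_fun f) (re_fun (partials [:: i] f))
    (re_fun (partials [:: j] f)) (re_fun (partials [:: i; j] f))
    (re_fun (partials [:: j; i] f)) U x i j oU Ux (fun y Uy => (P [::] i y Uy).1)
    (fun y Uy => (P [::] j y Uy).1) (fun y Uy => (P [:: i] j y Uy).1)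
    (fun y Uy => (P [:: j] i y Uy).1)).
- exact: (@schwarz_real (im_fun f) (im_fun (partials [:: i] f))
    (im_fun (partials [:: j] f)) (im_fun (partials [:: i; j] f))
    (im_fun (partials [:: j; i] f)) U x i j oU Ux (fun y Uy => (P [::] i y Uy).2)
    (fun y Uy => (P [::] j y Uy).2) (fun y Uy => (P [:: i] j y Uy).2)
    (fun y Uy => (P [:: j] i y Uy).2)).
Qed.

(** Two adjacent derivations commute, hence a derivation can be moved through a
    list of others up to its front. *)
Lemma partials_perm U f s t : open U -> smooth U f -> perm_eq s t ->
  forall x, U x -> partials s f x = partials t f x.
Proof.
move=> oU sf.
have bubble i t1 t2 x : U x ->
    partials (i :: t1 ++ t2) f x = partials (t1 ++ i :: t2) f x.
  elim: t1 x => [//|j t1 IH] x Ux.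
  have := partialsC i j oU (smooth_partials (t1 ++ t2) sf) Ux.
  rewrite -!partials_cat /= => ->.
  exact: (@partials_congr U _ _ oU IH [:: j]).
elim: s t => [|i s IH] t st x Ux.
  by move: st; rewrite perm_sym => /perm_nilP ->.
have it : i \in t by rewrite -(perm_mem st) mem_head.
case/splitPr: it st => t1 t2 st; rewrite -bubble //.
apply: (@partials_congr U _ _ oU _ [:: i]) => // y Uy; apply: IH => //.
by rewrite -(perm_cons i) (permPl st) -cat1s perm_catCA.
Qed.

(** The derivatives indexed by multi-indices, which alone enter the seminorms,
    are thus all the derivatives. *)
Lemma partials_mderiv U f s x : open U -> smooth U f -> U x ->
  partials s f x = mderiv [ffun i => count_mem i s] f x.
Proof.
move=> oU sf Ux; apply: (partials_perm oU sf) => //.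
apply/allP => k _ /=; apply/eqP.
rewrite count_flatten -map_comp sumnE big_map.
rewrite (bigD1_seq k) ?mem_enum ?enum_uniq //= ffunE count_nseq /= eqxx mul1n.
rewrite big1_seq ?addn0 // => i /andP[ik _].
by rewrite count_nseq /= (negbTE ik) mul0n.
Qed.

End Schwarz.

(** * Measurability and weights on row vectors *)

Section Measurability.
Variables (R : realType) (d : nat) (disp : measure_display)
  (T : measurableType disp) (phi : T -> 'rV[R]_d).
Hypothesis mphi : forall i, measurable_fun setT (fun t => phi t 0 i).

Let box (q : 'rV[rat]_d * 'rV[rat]_d) : set 'rV[R]_d :=
  [set x | forall i, ratr (q.1 0 i) < x 0 i < ratr (q.2 0 i)].

(** Measurability of the coordinates suffices, as an open set is a countable
    union of boxes with rational vertices. *)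
Lemma measurable_preimage_open (V : set 'rV[R]_d) : open V ->
  measurable (phi @^-1` V).
Proof.
move=> oV.
have mbox q : measurable (phi @^-1` box q).
  have -> : phi @^-1` box q = \bigcap_(i in [set: 'I_d])
      ((fun t => phi t 0 i) @^-1` `]ratr (q.1 0 i), ratr (q.2 0 i)[).
    apply/seteqP; split=> t H; first by move=> i _ /=; rewrite in_itv /=; exact: H.
    by move=> i; have := H i I; rewrite /= in_itv.
  apply: fin_bigcap_measurable => // i _.
  by rewrite -[X in measurable X]setTI; apply: mphi => //; exact: measurable_itv.
have -> : phi @^-1` V = \bigcup_(q in [set: 'rV[rat]_d * 'rV[rat]_d])
    (if `[< box q `<=` V >] then phi @^-1` box q else set0).
  apply/seteqP; split=> t; last first.
    by move=> [q _]; case: asboolP => // qV /qV.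
  move=> Vt; have [r /= r0 Br] := (@nbhs_ballP _ _ _ _).1 (open_nbhs_nbhs (conj oV Vt)).
  have /choice[a ha] (i : 'I_d) : exists q : rat,
      (ratr q : R) \in `](phi t 0 i - r), (phi t 0 i)[.
    by apply: rat_in_itvoo; rewrite gtrBl.
  have /choice[b hb] (i : 'I_d) : exists q : rat,
      (ratr q : R) \in `](phi t 0 i), (phi t 0 i + r)[.
    by apply: rat_in_itvoo; rewrite ltrDl.
  exists (\row_i a i, \row_i b i) => //.
  case: asboolP => [_ i /=|[]].
    rewrite !mxE; have := ha i; have := hb i; rewrite !in_itv /=.
    by move=> /andP[-> _] /andP[_ ->].
  move=> x bx; apply: Br; split=> // i j; rewrite (ord1 i) /ball /=.
  have := bx j; rewrite /= !mxE => /andP[ax xb].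
  have := ha j; have := hb j; rewrite !in_itv /= => /andP[h1 h2] /andP[h3 h4].
  rewrite ltr_norml; apply/andP; split.
    by rewrite ltrNl opprB ltrBlDl (lt_trans xb).
  by rewrite ltrBlDr -ltrBlDl (lt_trans h3).
apply: countable_bigcupT_measurable => [|q]; first exact: countableP.
by case: asboolP.
Qed.

Lemma measurable_comp_continuous (V : set 'rV[R]_d) (f : 'rV[R]_d -> R) :
  open V -> (forall x, V x -> {for x, continuous f}) ->
  measurable_fun (phi @^-1` V) (f \o phi).
Proof.
move=> oV cf; apply: (measurability _ (RGenOpens.measurableE R)).
move=> _ [_ [a [b ->] <-]].
have -> : phi @^-1` V `&` (f \o phi) @^-1` `]a, b[%classic =
    phi @^-1` (V `&` f @^-1` `]a, b[%classic) by [].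
apply: measurable_preimage_open; rewrite openE => x [Vx fx].
apply: filterI; first exact: open_nbhs_nbhs.
apply: cf Vx _ _; apply: open_nbhs_nbhs; split => //; exact: interval_open.
Qed.

End Measurability.

Section Weights.
Variable R : realType.
Local Notation T := (measurableTypeR R).
Local Notation mu := (@lebesgue_measure R).

Lemma measurable_trow_coord n i :
  measurable_fun setT (fun t : n.-tuple T => trow t 0 i : R).
Proof.
have -> : (fun t : n.-tuple T => trow t 0 i) = (fun t : n.-tuple T => tnth t i).
  by apply/funext => t; rewrite mxE.
exact: measurable_tnth.
Qed.

Lemma measurable_prod_tnth n (g : R -> R) : measurable_fun setT g ->
  measurable_fun setT (fun t : n.-tuple T => \prod_(i < n) g (tnth t i)).
Proof.
move=> mg; apply: measurable_prod => i _.
by apply: measurableT_comp => //; exact: measurable_tnth.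
Qed.

(** Tonelli, one coordinate at a time. *)
Lemma integral_leb_prod n (g : R -> R) (c : R) : (forall x, 0 <= g x) ->
  measurable_fun setT g -> (\int[mu]_x (g x)%:E = c%:E)%E ->
  (\int[leb R n]_t (\prod_(i < n) g (tnth t i))%:E = (c ^+ n)%:E)%E.
Proof.
move=> g0 mg gc; elim: n => [|n IH].
  rewrite /= integral_dirac //; last by apply/measurable_EFinP; exact: measurable_prod_tnth.
  by rewrite diracT mul1e big_ord0 expr0.
have mP := @measurable_prod_tnth n.+1 g mg.
rewrite /= ge0_integral_pushforward //=; last 3 first.
- exact: measurable_tcons.
- exact/measurable_EFinP.
- by move=> t _; rewrite lee_fin; apply: prodr_ge0.
rewrite preimage_setT fubini_tonelli1 /=; last 2 first.
- apply/measurable_EFinP.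
  by apply: (measurableT_comp mP); exact: measurable_tcons.
- by move=> t; rewrite lee_fin; apply: prodr_ge0.
under eq_integral => x _.
  rewrite /fubini_F /=.
  under eq_integral => t _.
    rewrite big_ord_recl EFinM (_ : tnth _ ord0 = x) //.
    under eq_bigr => i _ do rewrite tnthS.
    over.
  rewrite ge0_integralZl //; first last.
  - by rewrite lee_fin.
  - by move=> t _; rewrite lee_fin; apply: prodr_ge0.
  - by apply/measurable_EFinP; exact: measurable_prod_tnth.
  rewrite IH.
  over.
rewrite ge0_integralZr // ?gc; first by rewrite -EFinM exprS.
- exact/measurable_EFinP.
- by move=> x _; rewrite lee_fin.
- rewrite lee_fin exprn_ge0 // -lee_fin -gc.
  by apply: integral_ge0 => x _; rewrite lee_fin.
Qed.

Lemma oneDsqr_pos (x : R) : 0 < oneDsqr x.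
Proof. exact: lt_le_trans ltr01 (oneDsqr_ge1 x). Qed.

(** An integrable function on R^n of polynomial decay, which hence dominates
    every function that decays faster than all powers. *)
Definition weight n (x : 'rV[R]_n) : R := \prod_(i < n) (oneDsqr (x 0 i))^-1.

Lemma weight_gt0 n (x : 'rV[R]_n) : 0 < weight x.
Proof. by apply: prodr_gt0 => i _; rewrite invr_gt0 oneDsqr_pos. Qed.

Lemma oneDsqrV_ge0 (x : R) : 0 <= (oneDsqr x)^-1.
Proof. by rewrite invr_ge0 ltW // oneDsqr_pos. Qed.

Lemma integral_oneDsqrV : (\int[mu]_x ((oneDsqr x)^-1)%:E = (pi : R)%:E)%E.
Proof.
rewrite (@ge0_symfun_integralT _ (fun x => (oneDsqr x)^-1))//=.
- rewrite (_ : [set x | _] = `[0, +oo[%classic); last first.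
    by apply/seteqP; split => x/=; rewrite in_itv/= andbT.
  by rewrite integral0y_oneDsqr -EFinM mulrCA divff// mulr1.
- exact: continuous_oneDsqrV.
- by move=> x/=; rewrite /oneDsqr sqrrN.
Qed.

Lemma integrable_weight n :
  (leb R n).-integrable setT (fun t => (weight (trow t))%:E).
Proof.
have E t : weight (trow t) = \prod_(i < n) (oneDsqr (tnth t i))^-1.
  by apply: eq_bigr => i _; rewrite mxE.
have mV : measurable_fun setT (fun x : R => (oneDsqr x)^-1).
  by apply: continuous_measurable_fun; exact: continuous_oneDsqrV.
apply/integrableP; split.
  apply/measurable_EFinP; under eq_fun do rewrite E.
  exact: (@measurable_prod_tnth n (fun x => (oneDsqr x)^-1)).
under eq_integral => t _.
  rewrite gee0_abs ?lee_fin ?(ltW (weight_gt0 _)) // E.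
  over.
rewrite (@integral_leb_prod n (fun x => (oneDsqr x)^-1) pi) ?ltry //.
exact: integral_oneDsqrV.
Qed.

Definition gaussian n (x : 'rV[R]_n) : R := expR (\sum_(i < n) - (x 0 i ^+ 2)).

Lemma integral_gaussian n :
  (\int[leb R n]_t (gaussian (trow t))%:E = (Num.sqrt pi ^+ n)%:E)%E.
Proof.
rewrite -(@integral_leb_prod n (@gauss_fun R) _ (@gauss_fun_ge0 R)
  (@measurable_gauss_fun R) (@integralT_gauss R)).
apply: eq_integral => t _; rewrite /gaussian expR_sum.
by congr (_ %:E); apply: eq_bigr => i _; rewrite mxE.
Qed.

Lemma integrable_weight2 n : (leb R n \x leb R n)%E.-integrable setT
  (fun p => (weight (trow p.1) * weight (trow p.2))%:E).
Proof.
have iw := integrable_weight n.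
have /integrableP[mw iwoo] := iw.
have /measurable_EFinP mw' := mw.
have mW : measurable_fun setT (fun p : n.-tuple T * n.-tuple T =>
    (weight (trow p.1) * weight (trow p.2))%:E).
  apply/measurable_EFinP; apply: measurable_funM.
    by apply: (measurableT_comp mw'); exact: measurable_fst.
  by apply: (measurableT_comp mw'); exact: measurable_snd.
apply: (@integrable12ltyP _ _ _ _ R (leb R n) (leb R n) _ mW).2 => /=.
have woo : (\int[leb R n]_t (weight (trow t))%:E < +oo)%E.
  by move: iwoo; under eq_integral => t _ do rewrite gee0_abs ?lee_fin ?(ltW (weight_gt0 _)) //.
under eq_integral => x _.
  under eq_integral => y _.
    rewrite ger0_norm ?mulr_ge0 ?(ltW (weight_gt0 _)) // EFinM; over.
  rewrite ge0_integralZl ?lee_fin ?(ltW (weight_gt0 _)) //; last first.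
    by move=> y _; rewrite lee_fin ltW // weight_gt0.
  over.
rewrite ge0_integralZr //; last 2 first.
- by move=> y _; rewrite lee_fin ltW // weight_gt0.
- by apply: integral_ge0 => y _; rewrite lee_fin ltW // weight_gt0.
apply: lte_mul_pinfty => //.
  by apply: integral_ge0 => y _; rewrite lee_fin ltW // weight_gt0.
rewrite ge0_fin_numE //.
by apply: integral_ge0 => y _; rewrite lee_fin ltW // weight_gt0.
Qed.

End Weights.

(** * Complex integrals and integrals depending on a parameter *)

Section NormcBounds.
Variable R : realType.
Implicit Type z : R[i].

Lemma norm_Re_le z : `|complex.Re z| <= normc z.
Proof.
by case: z => a b /=; rewrite -sqrtr_sqr ler_sqrt ?addr_ge0 ?sqr_ge0 // lerDl sqr_ge0.
Qed.

Lemma norm_Im_le z : `|complex.Im z| <= normc z.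
Proof.
by case: z => a b /=; rewrite -sqrtr_sqr ler_sqrt ?addr_ge0 ?sqr_ge0 // lerDr sqr_ge0.
Qed.

Lemma normc_le_ReIm z : normc z <= `|complex.Re z| + `|complex.Im z|.
Proof.
case: z => a b /=; rewrite -[leRHS]ger0_norm ?addr_ge0 // -sqrtr_sqr.
rewrite ler_sqrt ?sqr_ge0 // sqrrD !real_normK ?num_real //.
by rewrite -addrA lerD2l lerDr mulrn_wge0 // mulr_ge0.
Qed.

End NormcBounds.

Section ComplexIntegral.
Variables (R : realType) (disp : measure_display) (T : measurableType disp)
  (mu : {measure set T -> \bar R}) (D : set T).
Hypothesis mD : measurable D.
Implicit Types (f : T -> R[i]) (g : T -> R).

Definition cintegrable f : Prop :=
  mu.-integrable D (EFin \o (fun t => complex.Re (f t))) /\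
  mu.-integrable D (EFin \o (fun t => complex.Im (f t))).

Definition cmeasurable f : Prop :=
  measurable_fun D (fun t => complex.Re (f t)) /\ measurable_fun D (fun t => complex.Im (f t)).

Lemma cintegrable_dom f g : cmeasurable f ->
  mu.-integrable D (EFin \o g) -> (forall t, D t -> normc (f t) <= g t) ->
  cintegrable f.
Proof.
move=> [mr mi] ig H; split; apply: le_integrable ig => //.
- exact/measurable_EFinP.
- move=> t Dt; rewrite /= lee_fin; apply: le_trans (norm_Re_le _) _.
  exact: le_trans (H t Dt) (ler_norm _).
- exact/measurable_EFinP.
- move=> t Dt; rewrite /= lee_fin; apply: le_trans (norm_Im_le _) _.
  exact: le_trans (H t Dt) (ler_norm _).
Qed.

(** The factor 2 comes from estimating the real and imaginary parts
    separately. *)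
Lemma normc_Cintegral_le f g : cmeasurable f ->
  mu.-integrable D (EFin \o g) -> (forall t, D t -> normc (f t) <= g t) ->
  normc (Cintegral mu D f) <= 2 * Rintegral mu D g.
Proof.
move=> mf ig H; have [ir ii] := cintegrable_dom mf ig H.
apply: le_trans (normc_le_ReIm _) _; rewrite mulr_natl mulr2n /=.
apply: lerD; apply: (le_trans (le_normr_Rintegral mD _)) => //.
- apply: le_Rintegral => //; first exact: integrable_norm.
  by move=> t Dt; exact: le_trans (norm_Re_le _) (H t Dt).
- apply: le_Rintegral => //; first exact: integrable_norm.
  by move=> t Dt; exact: le_trans (norm_Im_le _) (H t Dt).
Qed.

Lemma eq_Cintegral f f' : (forall t, D t -> f t = f' t) ->
  Cintegral mu D f = Cintegral mu D f'.
Proof.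
move=> ff'; rewrite /Cintegral; congr (_ +i* _);
  by apply: eq_Rintegral => t /set_mem Dt; rewrite ff'.
Qed.

Lemma CintegralB f f' : cintegrable f -> cintegrable f' ->
  Cintegral mu D (fun t => f t - f' t) = Cintegral mu D f - Cintegral mu D f'.
Proof.
move=> [fr fi] [fr' fi']; rewrite {2 3}/Cintegral.
apply/eqP; rewrite eq_complex /=; apply/andP; split; apply/eqP.
- rewrite -RintegralB //; apply: eq_Rintegral => t _.
  by case: (f t) (f' t) => [a b] [a' b'].
- rewrite -RintegralB //; apply: eq_Rintegral => t _.
  by case: (f t) (f' t) => [a b] [a' b'].
Qed.

Lemma CintegralZl (c : R[i]) f : cintegrable f ->
  Cintegral mu D (fun t => c * f t) = c * Cintegral mu D f.
Proof.
case: c => a b [fr fi]; rewrite {2}/Cintegral.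
have Z (k : R) (h : T -> R) : mu.-integrable D (EFin \o h) ->
    mu.-integrable D (EFin \o (fun t => k * h t)).
  by move=> ih; exact: (integrableZl mD k ih).
apply/eqP; rewrite eq_complex /=; apply/andP; split; apply/eqP.
- rewrite -!RintegralZl // -RintegralB //; [|exact: Z|exact: Z].
  by apply: eq_Rintegral => t _; case: (f t).
- rewrite -!RintegralZl // -RintegralD //; [|exact: Z|exact: Z].
  by apply: eq_Rintegral => t _; case: (f t).
Qed.

End ComplexIntegral.

Section FubiniWeight.
Variables (R : realType) (n : nat).
Local Notation T := (n.-tuple (measurableTypeR R)).
Local Notation mu := (leb R n).

Let wt (t : T) : R := weight (trow t).

Lemma Rintegral_fubini_weight (h : T * T -> R) (C : R) :
  measurable_fun setT h ->
  (forall p, `|h p| <= C * (wt p.1 * wt p.2)) ->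
  Rintegral (mu \x mu)%E setT h =
  Rintegral mu setT (fun y => Rintegral mu setT (fun xi => h (y, xi))).
Proof.
move=> mh hC.
have ih : (mu \x mu)%E.-integrable setT (EFin \o h).
  have iW := integrableZl measurableT C (@integrable_weight2 R n).
  apply: le_integrable iW => //; first exact/measurable_EFinP.
  move=> p _ /=; rewrite lee_fin; apply: le_trans (hC p) (ler_norm _).
rewrite /Rintegral -(integral12_prod_meas1 ih) /fubini_F.
congr fine; apply: eq_integral => y _; rewrite fineK //.
apply: integrable_fin_num => //.
have iw := integrableZl measurableT (C * wt y) (@integrable_weight R n).
apply: le_integrable iw => //.
  by apply/measurable_EFinP; apply: (measurableT_comp mh); exact: measurable_pair1.
move=> xi _ /=; rewrite lee_fin; apply: le_trans (hC _) _.
by rewrite mulrA ler_norm.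
Qed.

(** The domination makes all sections integrable, so that the inner integral is
    finite at every point and not just almost everywhere. *)
Lemma Cintegral_fubini_weight (D : set T) (f : T * T -> R[i]) (C : R) :
  measurable D -> cmeasurable [set p | D p.1] f ->
  (forall p, D p.1 -> normc (f p) <= C * (wt p.1 * wt p.2)) ->
  Cintegral (mu \x mu)%E [set p | D p.1] f =
  Cintegral mu D (fun y => Cintegral mu setT (fun xi => f (y, xi))).
Proof.
move=> mD [mr mi] H.
have mDD : measurable [set p : T * T | D p.1].
  by rewrite -[X in measurable X]setTI; exact: measurable_fst.
have key (h : T * T -> R) : measurable_fun [set p | D p.1] h ->
    (forall p, D p.1 -> `|h p| <= C * (wt p.1 * wt p.2)) ->
    Rintegral (mu \x mu)%E [set p | D p.1] h =
    Rintegral mu D (fun y => Rintegral mu setT (fun xi => h (y, xi))).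
  move=> mh hC; rewrite Rintegral_mkcond [RHS]Rintegral_mkcond.
  rewrite (@Rintegral_fubini_weight _ `|C|); last 2 first.
  - exact: ((measurable_restrictT _ mDD).1 mh).
  - move=> p; rewrite /patch; case: ifPn => [/set_mem Dp|_].
      apply: le_trans (hC p Dp) _; rewrite ler_wpM2r ?ler_norm //.
      by rewrite mulr_ge0 // ltW // weight_gt0.
    by rewrite normr0 !mulr_ge0 // ltW // weight_gt0.
  apply: eq_Rintegral => y _; rewrite /patch; case: ifPn => [/set_mem Dy|nDy].
    by apply: eq_Rintegral => xi _; rewrite mem_set.
  transitivity (0 : R) => //; rewrite -[RHS](mul0r (fine (mu setT))).
  rewrite -(@Rintegral_cst _ _ _ mu _ measurableT 0).
  apply: eq_Rintegral => xi _; rewrite memNset //.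
  by move/mem_set; exact/negP.
rewrite /Cintegral; congr (_ +i* _); rewrite key //.
  by move=> p Dp; apply: le_trans (norm_Re_le _) (H p Dp).
by move=> p Dp; apply: le_trans (norm_Im_le _) (H p Dp).
Qed.

End FubiniWeight.

Section ParameterIntegral.
Variables (R : realType) (d : nat) (disp : measure_display)
  (T : measurableType disp) (mu : {measure set T -> \bar R}).
Variables (g : 'rV[R]_d -> T -> R) (G : T -> R) (w : 'rV[R]_d) (r : R).
Hypotheses (r0 : 0 < r) (iG : mu.-integrable setT (EFin \o G)).
Hypothesis mg : forall x, ball w r x -> measurable_fun setT (g x).

(** Dominated convergence is about sequences; a discontinuity at w would give a
    sequence tending to w along which the integral stays away from its value
    there. *)
Lemma continuous_param_integral :
  (forall x t, ball w r x -> `|g x t| <= G t) ->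
  (forall t, {for w, continuous (fun x => g x t)}) ->
  {for w, continuous (fun x => Rintegral mu setT (g x))}.
Proof.
move=> gG cg; rewrite /prop_for /continuous_at.
apply/(@cvgrPdist_le _ _ _ (nbhs w)) => e e0.
apply: contrapT => nF.
have /choice[x hx] (k : nat) : exists x, ball w (r / k.+1%:R) x /\
    ~ `|Rintegral mu setT (g w) - Rintegral mu setT (g x)| <= e.
  apply: contrapT => H; apply: nF; apply/nbhs_ballP.
  exists (r / k.+1%:R); first by rewrite /= divr_gt0.
  by move=> x bx; apply: contrapT => nx; apply: H; exists x.
have bx k : ball w r (x k).
  apply: le_ball (hx k).1.
  by rewrite ler_pdivrMr ?ltr0n // ler_peMr ?ler1n // ltW.
have xw : x k @[k --> \oo] --> w.
  apply/cvgrPdist_lt => eta eta0.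
  have : (r / k.+1%:R : R) @[k --> \oo] --> (0 : R).
    rewrite -[X in _ --> X](mulr0 r); apply: cvgM; first exact: cvg_cst.
    exact: cvg_harmonic.
  move=> /cvgr0Pnorm_lt /(_ _ eta0); apply: filterS => k hk.
  have := (hx k).1; rewrite -ball_normE /= => /lt_trans; apply.
  by move: hk; rewrite gtr0_norm // divr_gt0.
have bw : ball w r w by exact: ballxx.
have : (\int[mu]_t (g (x k) t)%:E)%E @[k --> \oo] --> (\int[mu]_t (g w t)%:E)%E.
  apply: (@dominated_cvg _ _ _ mu setT measurableT
     (fun k t => (g (x k) t)%:E) _ (EFin \o G)) => //.
  - by move=> k; apply/measurable_EFinP; exact: mg.
  - move=> t _; apply: cvg_EFin; first exact: nearW.
    exact: (cvg_comp _ _ xw (cg t)).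
  - by move=> k t _ /=; rewrite lee_fin; exact: gG.
have fin y : ball w r y -> (\int[mu]_t (g y t)%:E)%E \is a fin_num.
  move=> by_; apply: integrable_fin_num => //.
  apply: le_integrable iG => //; first exact/measurable_EFinP/mg.
  by move=> t _ /=; rewrite lee_fin (le_trans (gG _ _ by_)) // ler_norm.
rewrite -(fineK (fin w bw)) => /fine_cvg /cvgrPdist_le /(_ _ e0) [N _ /(_ N)].
by move=> /(_ (leqnn N)) /=; exact: (hx N).2.
Qed.

Variables (v : 'rV[R]_d) (dg : 'rV[R]_d -> T -> R).
Hypothesis nv : `|v| <= 1.

(** Along the line through w in the direction v the parameter is real; as v has
    norm at most 1, parameters in ]-r, r[ keep the line inside the ball. *)
Lemma is_derive_param_integral :
  (forall x, ball w r x -> mu.-integrable setT (EFin \o g x)) ->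
  (forall x t, ball w r x -> is_derive x v (fun y => g y t) (dg x t)) ->
  (forall x t, ball w r x -> `|dg x t| <= G t) ->
  is_derive w v (fun x => Rintegral mu setT (g x)) (Rintegral mu setT (dg w)).
Proof.
move=> ig dgP dgG; pose f (h : R) (t : T) := g (h *: v + w) t.
have line h : h \in `](- r), r[ -> ball w r (h *: v + w).
  rewrite in_itv /= -ltr_norml => hr; rewrite -ball_normE /=.
  rewrite opprD addrCA subrr addr0 normrN normrZ.
  by apply: le_lt_trans hr; rewrite ler_piMr.
have dline h t : h \in `](- r), r[ -> is_derive h 1 (f ^~ t) (dg (h *: v + w) t).
  by move=> hr; apply: (is_derive_slice (dgP _ t (line h hr))).
have G0 t : 0 <= G t.
  by apply: le_trans (dgG w t _); [exact: normr_ge0|exact: ballxx].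
have I0 : `](- r), r[%classic (0 : R) by rewrite /= in_itv /= oppr_lt0 r0.
have A1 x : `](- r), r[%classic x -> mu.-integrable setT (EFin \o f x).
  by move=> xr; apply: ig; exact: line.
have A2 x y : `](- r), r[%classic x -> setT y -> derivable (f ^~ y) x 1.
  by move=> xr _; have [] := dline x y xr.
have A3 x y : `](- r), r[%classic x -> setT y -> `|partial1of2 f x y| <= G y.
  move=> xr _; rewrite partial1of2E; have [_ ->] := dline x y xr.
  exact: dgG (line x xr).
have E0 := differentiation_under_integral measurableT I0 A1 A2 G0 iG A3.
have E1 := derivable_under_integral measurableT I0 A1 A2 G0 iG A3.
apply/is_derive_line; apply: DeriveDef; first exact: E1.
rewrite -derive1E E0; apply: eq_Rintegral => t _.
rewrite partial1of2E.
by have [_ ->] := dline 0 t I0; rewrite scale0r add0r.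
Qed.

End ParameterIntegral.

(** * Integration over the frequency variable *)

Lemma nonexpansive_continuous (R : realType) (p q : nat)
    (f : 'rV[R]_p -> 'rV[R]_q) : (forall x y, `|f x - f y| <= `|x - y|) ->
  forall x, {for x, continuous f}.
Proof.
move=> H x; rewrite /prop_for /continuous_at.
apply/(@cvgrPdist_le _ _ _ (nbhs x)) => e e0.
apply/nbhs_ballP; exists e => //= y; rewrite -ball_normE /= => xy.
exact: le_trans (H x y) (ltW xy).
Qed.

Section RowMx.
Variables (R : realType) (d n : nat).
Implicit Types (x y : 'rV[R]_d) (xi : 'rV[R]_n) (z : 'rV[R]_(d + n)).

Lemma line_row_mxl (h : R) (i : 'I_d) x xi :
  h *: basis_vec R (lshift n i) + row_mx x xi =
  row_mx (h *: basis_vec R i + x) xi.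
Proof.
apply/rowP => j; rewrite !mxE; case: (split_ordP j) => k ->.
  by rewrite !mxE eqxx /= (inj_eq (@lshift_inj _ _)).
by rewrite eqxx /= eq_rlshift mulr0 add0r.
Qed.

Lemma line_lsubmxl (h : R) (i : 'I_d) z :
  lsubmx (h *: basis_vec R (lshift n i) + z) = h *: basis_vec R i + lsubmx z.
Proof. by rewrite -{1}[z]hsubmxK line_row_mxl row_mxKl. Qed.

Lemma line_lsubmxr (h : R) (j : 'I_n) z :
  lsubmx (h *: basis_vec R (rshift d j) + z) = lsubmx z.
Proof.
by apply/rowP => i; rewrite !mxE eqxx /= eq_lrshift mulr0 add0r.
Qed.

Lemma continuous_row_mxl xi x : {for x, continuous (fun y => row_mx y xi)}.
Proof.
apply: nonexpansive_continuous => y y'; rewrite opp_row_mx add_row_mx subrr.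
apply: rv_norm_le => // j; rewrite mxE; case: split_ordP => k _.
  exact: rv_coord_le.
by rewrite mxE normr0.
Qed.

Lemma continuous_row_mxr x xi : {for xi, continuous (fun eta => row_mx x eta)}.
Proof.
apply: nonexpansive_continuous => y y'; rewrite opp_row_mx add_row_mx subrr.
apply: rv_norm_le => // j; rewrite mxE; case: split_ordP => k _.
  by rewrite mxE normr0.
exact: rv_coord_le.
Qed.

Lemma continuous_lsubmx z :
  {for z, continuous (lsubmx : 'rV[R]_(d + n) -> 'rV[R]_d)}.
Proof.
apply: nonexpansive_continuous => y y'; rewrite -raddfB.
by apply: rv_norm_le => // j; rewrite mxE; exact: rv_coord_le.
Qed.

Lemma continuous_rsubmx z :
  {for z, continuous (rsubmx : 'rV[R]_(d + n) -> 'rV[R]_n)}.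
Proof.
apply: nonexpansive_continuous => y y'; rewrite -raddfB.
by apply: rv_norm_le => // j; rewrite mxE; exact: rv_coord_le.
Qed.

Lemma ccont_row_mxl (f : 'rV[R]_(d + n) -> R[i]) x xi :
  ccont f (row_mx x xi) -> ccont (fun y => f (row_mx y xi)) x.
Proof.
move=> [cr ci]; split.
  exact: (@continuous_comp _ _ _ (fun y => row_mx y xi) (re_fun f) x
    (@continuous_row_mxl xi x) cr).
exact: (@continuous_comp _ _ _ (fun y => row_mx y xi) (im_fun f) x
  (@continuous_row_mxl xi x) ci).
Qed.

Lemma has_partial_row_mxl (f : 'rV[R]_(d + n) -> R[i]) i x xi l :
  has_partial (lshift n i) f (row_mx x xi) l ->
  has_partial i (fun y => f (row_mx y xi)) x l.
Proof.
move=> [/is_derive_line dr /is_derive_line di]; split; apply/is_derive_line.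
  move: dr; congr (is_derive _ _ _ _); apply/funext => h.
  by rewrite line_row_mxl.
move: di; congr (is_derive _ _ _ _); apply/funext => h.
by rewrite line_row_mxl.
Qed.

Lemma has_partial_lsubl (k : 'rV[R]_d -> R[i]) i z l :
  has_partial i k (lsubmx z) l ->
  has_partial (lshift n i) (fun z => k (lsubmx z)) z l.
Proof.
move=> [/is_derive_line dr /is_derive_line di]; split; apply/is_derive_line.
  move: dr; congr (is_derive _ _ _ _); apply/funext => h.
  by rewrite /re_fun line_lsubmxl.
move: di; congr (is_derive _ _ _ _); apply/funext => h.
by rewrite /im_fun line_lsubmxl.
Qed.

Lemma has_partial_lsubr (k : 'rV[R]_d -> R[i]) (j : 'I_n) z :
  has_partial (rshift d j) (fun z => k (lsubmx z)) z 0.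
Proof.
split; apply/is_derive_line.
  have := is_derive_cst (re_fun k (lsubmx z)) (0 : R) (1 : R).
  congr (is_derive _ _ _ _); apply/funext => h.
  by rewrite /re_fun line_lsubmxr.
have := is_derive_cst (im_fun k (lsubmx z)) (0 : R) (1 : R).
congr (is_derive _ _ _ _); apply/funext => h.
by rewrite /im_fun line_lsubmxr.
Qed.

Lemma ccont_lsubmx (k : 'rV[R]_d -> R[i]) z : ccont k (lsubmx z) ->
  ccont (fun z => k (lsubmx z)) z.
Proof.
move=> [cr ci]; split.
  exact: (@continuous_comp _ _ _ lsubmx (re_fun k) z (@continuous_lsubmx z) cr).
exact: (@continuous_comp _ _ _ lsubmx (im_fun k) z (@continuous_lsubmx z) ci).
Qed.

Lemma ccont_rsubmx (k : 'rV[R]_n -> R[i]) z : ccont k (rsubmx z) ->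
  ccont (fun z => k (rsubmx z)) z.
Proof.
move=> [cr ci]; split.
  exact: (@continuous_comp _ _ _ rsubmx (re_fun k) z (@continuous_rsubmx z) cr).
exact: (@continuous_comp _ _ _ rsubmx (im_fun k) z (@continuous_rsubmx z) ci).
Qed.

Section Pullback.
Variable O : openset R d.
Let U := oset (cart O (whole R n)).

(** A derivative of a function of the first block of variables is a derivative
    of k, or 0 if a variable of the second block occurs in it. Which case holds
    does not depend on k, hence is the same along a net. *)
Lemma partials_lsubmx s : exists r : option (seq 'I_d),
  forall k, smooth O k -> forall z, U z ->
    partials s (fun z => k (lsubmx z)) z =
    if r is Some t then partials t k (lsubmx z) else 0.
Proof.
elim: s => [|i s [r E]]; first by exists (Some [::]).
have near k z : smooth O k -> U z -> \forall y \near z,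
    (if r is Some t then partials t k (lsubmx y) else 0) =
    partials s (fun z => k (lsubmx z)) y.
  move=> sk Uz; apply: near_open Uz _ => [|y Uy]; first exact: oset_open.
  by rewrite E.
case: r E near => [t|] E near; last first.
  exists None => k sk z Uz /=; apply: has_partial_val.
  exact: near_has_partial (near k z sk Uz) (has_partial_cst _ _ _).
case: (split_ordP i) => j ->.
  exists (Some (j :: t)) => k sk z Uz /=; apply: has_partial_val.
  apply: near_has_partial (near k z sk Uz) _; apply: has_partial_lsubl.
  by apply: smooth_has_partial sk _; case: Uz.
exists None => k sk z Uz /=; apply: has_partial_val.
exact: near_has_partial (near k z sk Uz) (has_partial_lsubr _ _ _).
Qed.

Lemma smooth_lsubmx k : smooth O k -> smooth U (fun z => k (lsubmx z)).
Proof.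
move=> sk; apply: smooth_of_partials => [|s]; first exact: oset_open.
have [[t|] E] := partials_lsubmx s; last first.
  exists (fun=> 0) => z Uz; first exact: E.
  split; first exact: ccont_cst.
  by move=> i; exists 0; exact: has_partial_cst.
exists (fun z => partials t k (lsubmx z)) => z Uz; first exact: E.
have [Oz _] := Uz.
split; first by apply: ccont_lsubmx; exact: smooth_ccont sk Oz.
move=> i; case: (split_ordP i) => j ->.
  by eexists; apply: has_partial_lsubl; apply: smooth_has_partial sk Oz.
by eexists; exact: has_partial_lsubr.
Qed.

End Pullback.

Lemma measurable_row_mx (disp : measure_display) (T : measurableType disp)
    (p : T -> 'rV[R]_d) (q : T -> 'rV[R]_n) :
  (forall i, measurable_fun setT (fun t => p t 0 i)) ->
  (forall i, measurable_fun setT (fun t => q t 0 i)) ->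
  forall i, measurable_fun setT (fun t => row_mx (p t) (q t) 0 i).
Proof.
move=> mp mq i; case: (split_ordP i) => j ->.
  by under eq_fun do rewrite row_mxEl; exact: mp.
by under eq_fun do rewrite row_mxEr; exact: mq.
Qed.

End RowMx.

Section FrequencyIntegral.
Variables (R : realType) (d n : nat) (O : openset R d).
Implicit Types (f : 'rV[R]_(d + n) -> R[i]) (x : 'rV[R]_d) (xi : 'rV[R]_n).
Let U := oset (cart O (whole R n)).

(** The domination that permits differentiating under the integral over xi, at
    any order and near any point of O. *)
Definition weight_decay f : Prop :=
  forall s (K : set 'rV[R]_d), compact K -> K `<=` O -> exists C : R,
    forall x xi, K x -> normc (partials s f (row_mx x xi)) <= C * weight xi.

Definition freq_integral f x : R[i] :=
  Cintegral (leb R n) setT (fun t => f (row_mx x (trow t))).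

Lemma cart_row_mx x xi : oset O x -> U (row_mx x xi).
Proof. by move=> Ox; split => //=; rewrite row_mxKl. Qed.

Lemma weight_decay_partials f t : weight_decay f -> weight_decay (partials t f).
Proof.
move=> df s K cK KO; have [C H] := df (s ++ t) K cK KO.
by exists C => x xi Kx; rewrite -partials_cat; exact: H.
Qed.

Lemma cmeasurable_slice f x : smooth U f -> oset O x ->
  cmeasurable setT (fun t : n.-tuple (measurableTypeR R) => f (row_mx x (trow t))).
Proof.
move=> sf Ox.
have mphi := @measurable_row_mx R d n _ _
  (fun t : n.-tuple (measurableTypeR R) => x) (@trow R n)
  (fun i => measurable_cst _) (@measurable_trow_coord R n).
have pre : (fun t : n.-tuple (measurableTypeR R) => row_mx x (trow t)) @^-1` U = setT.
  by apply/seteqP; split => // t _; exact: cart_row_mx.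
have oU : open U by exact: oset_open.
split.
  have := measurable_comp_continuous mphi oU (fun z Uz => (smooth_ccont [::] sf Uz).1).
  by rewrite pre.
have := measurable_comp_continuous mphi oU (fun z Uz => (smooth_ccont [::] sf Uz).2).
by rewrite pre.
Qed.

Lemma compact_nbhs_ball x : oset O x -> exists2 r : R, 0 < r &
  compact (closed_ball x r) /\ closed_ball x r `<=` O.
Proof.
move=> Ox; have nO : nbhs x (oset O).
  by apply: open_nbhs_nbhs; split => //; exact: oset_open.
have [r /= r0 Br] := (@nbhs_ballP _ _ _ _).1 nO.
have r2 : 0 < r / 2 by rewrite divr_gt0.
exists (r / 2) => //; split.
  apply: bounded_closed_compact; last exact: closed_ball_closed.
  exists (`|x| + r / 2); split; first exact: num_real.
  move=> M hM y; rewrite closed_ballE // => xy.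
  apply: le_trans _ (ltW hM); rewrite -[y](subrK x) addrC.
  by apply: (le_trans (ler_normD _ _)); rewrite lerD2l distrC.
move=> y; rewrite closed_ballE // => xy; apply: Br; rewrite -ball_normE /=.
by apply: le_lt_trans xy _; rewrite ltr_pdivrMr // ltr_pMr // ltr1n.
Qed.

Lemma cintegrable_slice f x : smooth U f -> weight_decay f -> oset O x ->
  cintegrable (leb R n) setT (fun t => f (row_mx x (trow t))).
Proof.
move=> sf df Ox.
have [C H] := df [::] [set x] (@compact_set1 _ x) (fun y yx => eq_ind_r (oset O) Ox yx).
have iw := integrableZl measurableT C (@integrable_weight R n).
apply: (cintegrable_dom measurableT (cmeasurable_slice sf Ox) iw) => t _ /=.
exact: H.
Qed.

(** Continuity and differentiability under the integral sign, with the bound of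
    [weight_decay] on a compact ball around x as dominating function. *)
Lemma freq_integral_C1 f x : smooth U f -> weight_decay f -> oset O x ->
  ccont (freq_integral f) x /\ forall i,
  has_partial i (freq_integral f) x (freq_integral (partial (lshift n i) f) x).
Proof.
move=> sf df Ox; have [r r0 [cK KO]] := compact_nbhs_ball Ox.
have bK y : ball x r y -> closed_ball x r y by move=> /subset_closed_ball.
have bO y : ball x r y -> oset O y by move=> /bK /KO.
have [C H] := df [::] _ cK KO.
have iG (C' : R) := integrableZl measurableT C' (@integrable_weight R n).
have mf y : ball x r y -> _ := fun b => cmeasurable_slice sf (bO y b).
have ig y : ball x r y -> _ := fun b => cintegrable_slice sf df (bO y b).
have cf (t : n.-tuple (measurableTypeR R)) :
    ccont (fun y => f (row_mx y (trow t))) x.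
  by apply: ccont_row_mxl; exact: (smooth_ccont [::] sf (cart_row_mx _ Ox)).
split.
  split.
    apply: (continuous_param_integral r0 (iG C)
      (g := fun y t => complex.Re (f (row_mx y (trow t))))).
    - by move=> y /mf [].
    - by move=> y t /bK Ky; apply: le_trans (norm_Re_le _) (H _ _ Ky).
    - by move=> t; have [] := cf t.
  apply: (continuous_param_integral r0 (iG C)
    (g := fun y t => complex.Im (f (row_mx y (trow t))))).
  - by move=> y /mf [].
  - by move=> y t /bK Ky; apply: le_trans (norm_Im_le _) (H _ _ Ky).
  - by move=> t; have [] := cf t.
move=> i; have [C' H'] := df [:: lshift n i] _ cK KO.
have dP y (t : n.-tuple (measurableTypeR R)) : ball x r y ->
    has_partial i (fun y => f (row_mx y (trow t))) y
      (partial (lshift n i) f (row_mx y (trow t))).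
  move=> b; apply: has_partial_row_mxl.
  exact: (smooth_has_partial [::] _ sf (cart_row_mx _ (bO y b))).
have nv := basis_vec_norm R i.
split.
  apply: (is_derive_param_integral r0 (iG C')
    (g := fun y t => complex.Re (f (row_mx y (trow t))))
    (dg := fun y t => complex.Re (partial (lshift n i) f (row_mx y (trow t))))) => //.
  - by move=> y /ig [].
  - by move=> y t /(dP y t) [].
  - by move=> y t /bK Ky; apply: le_trans (norm_Re_le _) (H' _ _ Ky).
apply: (is_derive_param_integral r0 (iG C')
  (g := fun y t => complex.Im (f (row_mx y (trow t))))
  (dg := fun y t => complex.Im (partial (lshift n i) f (row_mx y (trow t))))) => //.
- by move=> y /ig [].
- by move=> y t /(dP y t) [].
- by move=> y t /bK Ky; apply: le_trans (norm_Im_le _) (H' _ _ Ky).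
Qed.

Lemma partials_freq_integral f s x : smooth U f -> weight_decay f -> oset O x ->
  partials s (freq_integral f) x =
  freq_integral (partials (map (lshift n) s) f) x.
Proof.
move=> sf df; elim: s x => [//|i s IH] x Ox /=; apply: has_partial_val.
apply: (@near_has_partial _ _ _ (freq_integral (partials (map (lshift n) s) f))).
  by apply: near_open Ox _ => [|y /IH -> //]; exact: oset_open.
apply: (freq_integral_C1 _ _ Ox).2.
  exact: smooth_partials.
exact: weight_decay_partials.
Qed.

Lemma smooth_freq_integral f : smooth U f -> weight_decay f ->
  smooth O (freq_integral f).
Proof.
move=> sf df; apply: smooth_of_partials => [|s]; first exact: oset_open.
exists (freq_integral (partials (map (lshift n) s) f)) => x Ox.
  exact: partials_freq_integral.
have sf' : smooth U (partials (map (lshift n) s) f) by exact: smooth_partials.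
have df' : weight_decay (partials (map (lshift n) s) f).
  exact: weight_decay_partials.
have [cf pf] := freq_integral_C1 sf' df' Ox.
by split=> // i; eexists; exact: pf.
Qed.

Lemma freq_integral_bound f x (C : R) : smooth U f -> oset O x ->
  (forall xi, normc (f (row_mx x xi)) <= C * weight xi) ->
  normc (freq_integral f x) <=
    2 * Rintegral (leb R n) setT (fun t => weight (trow t)) * C.
Proof.
move=> sf Ox H.
have iw := integrableZl measurableT C (@integrable_weight R n).
have := @normc_Cintegral_le _ _ _ (leb R n) setT measurableT
  (fun t => f (row_mx x (trow t))) (fun t => C * weight (trow t))
  (cmeasurable_slice sf Ox) iw (fun t _ => H (trow t)).
rewrite RintegralZl //; last exact: integrable_weight.
by rewrite -mulrA [C * _]mulrC mulrA.
Qed.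

End FrequencyIntegral.

(** * Growth of nets of functions and of symbols *)

Section Japanese.
Variables (R : realType) (n : nat).
Implicit Type xi : 'rV[R]_n.

Lemma sum_sqr_ge0 xi : 0 <= \sum_(i < n) xi 0 i ^+ 2.
Proof. by apply: sumr_ge0 => i _; exact: sqr_ge0. Qed.

Lemma japanese_sqr xi : japanese xi ^+ 2 = 1 + \sum_(i < n) xi 0 i ^+ 2.
Proof. by rewrite sqr_sqrtr // addr_ge0 // sum_sqr_ge0. Qed.

Lemma japanese_ge1 xi : 1 <= japanese xi.
Proof. by rewrite -sqrtr1 ler_sqrt ?addr_ge0 ?sum_sqr_ge0 // lerDl sum_sqr_ge0. Qed.

Lemma japanese_ge0 xi : 0 <= japanese xi.
Proof. exact: sqrtr_ge0. Qed.

Lemma sqr_coord_le xi i : xi 0 i ^+ 2 <= \sum_(j < n) xi 0 j ^+ 2.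
Proof.
by rewrite (bigD1 i) //= lerDl; apply: sumr_ge0 => j _; exact: sqr_ge0.
Qed.

Lemma coord_le_japanese xi i : `|xi 0 i| <= japanese xi.
Proof.
rewrite -sqrtr_sqr ler_sqrt ?addr_ge0 ?sum_sqr_ge0 //.
by apply: (le_trans (sqr_coord_le xi i)); rewrite lerDr.
Qed.

(** Each factor 1 + xi_i^2 is at most <xi>^2. *)
Lemma japanese_weight xi : 1 <= japanese xi ^+ (2 * n) * weight xi.
Proof.
rewrite exprM japanese_sqr /weight -[X in _ ^+ X]card_ord -prodr_const -big_split.
elim/big_ind : _ => //= [x y|i _]; first exact: mulr_ege1.
rewrite ler_pdivlMr ?mul1r ?oneDsqr_pos // lerD2l; exact: sqr_coord_le.
Qed.

Lemma le_weight xi (B C : R) : japanese xi ^+ (2 * n) * B <= C ->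
  0 <= B -> B <= C * weight xi.
Proof.
move=> BC B0; apply: (@le_trans _ _ (japanese xi ^+ (2 * n) * B * weight xi)).
  by rewrite mulrAC ler_peMl // japanese_weight.
by rewrite ler_wpM2r // ltW // weight_gt0.
Qed.

(** With r = |xi|^2 and m = M + 1, the inequality t <= e^t at t = (1 + r) / m
    gives (1 + r)^m <= m^m e^(1 + r), and <xi>^2 = 1 + r. *)
Lemma japanese_gaussian M : exists2 C : R, 0 <= C &
  forall xi, japanese xi ^+ M * gaussian xi <= C.
Proof.
pose m : R := M.+1%:R; have m0 : 0 < m by rewrite ltr0n.
exists (m ^+ M.+1 * expR 1); first by rewrite mulr_ge0 ?expR_ge0 ?exprn_ge0 // ltW.
move=> xi; rewrite /gaussian -[in leRHS](subrK (\sum_(i < n) xi 0 i ^+ 2) 1) sumrN.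
set r := \sum_(i < n) _; have r0 : 0 <= r by exact: sum_sqr_ge0.
rewrite -addrA [- r + _]addrC addrA expRD mulrA ler_wpM2r ?expR_ge0 //.
apply: (@le_trans _ _ ((1 + r) ^+ M.+1)).
  rewrite -japanese_sqr -exprM mulnS mul2n -addnn.
  apply: ler_weXn2l; first exact: japanese_ge1.
  by rewrite addnCA leq_addr.
have -> : expR (1 + r) = expR ((1 + r) / m) ^+ M.+1.
  by rewrite -expRM_natl mulrC -mulrA mulVf ?mulr1 ?gt_eqF.
rewrite -exprMn; apply: lerXn2r; rewrite ?nnegrE ?addr_ge0 //.
  by rewrite mulr_ge0 ?expR_ge0 // ltW.
have : m * (1 + (1 + r) / m) <= m * expR ((1 + r) / m).
  by rewrite ler_pM2l // expR_ge1Dx.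
apply: le_trans.
by rewrite mulrDr mulr1 mulrC divfK ?gt_eqF // lerDr ltW.
Qed.

Lemma integrable_gaussian :
  (leb R n).-integrable setT (fun t => (gaussian (trow t))%:E).
Proof.
have [C C0 HC] := japanese_gaussian (2 * n).
have iw := integrableZl measurableT C (@integrable_weight R n).
apply: le_integrable iw => //.
  apply/measurable_EFinP.
  have := @measurable_prod_tnth R n (@gauss_fun R) (@measurable_gauss_fun R).
  congr (measurable_fun _ _); apply/funext => t.
  by rewrite /gaussian expR_sum; apply: eq_bigr => i _; rewrite mxE.
move=> t _ /=; rewrite lee_fin ger0_norm ?expR_ge0 //.
apply: le_trans _ (ler_norm _); apply: le_weight; first exact: HC.
exact: expR_ge0.
Qed.

End Japanese.

Section SymbolGrowth.
Variables (R : realType) (d n : nat).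

Lemma rpoly_bound (B : R) (u : 'rV[R]_(d + n) -> R) : 0 <= B -> rpoly u ->
  exists (C : R) (M : nat), 0 <= C /\ forall (x : 'rV[R]_d) (xi : 'rV[R]_n),
    `|x| <= B -> `|u (row_mx x xi)| <= C * japanese xi ^+ M.
Proof.
move=> B0; elim=> [c|j|{}u v _ [C [M [C0 Hu]]] _ [C' [M' [C0' Hv]]]|
  {}u v _ [C [M [C0 Hu]]] _ [C' [M' [C0' Hv]]]].
- by exists `|c|, 0%N; split => // x xi _; rewrite expr0 mulr1.
- case: (split_ordP j) => k ->.
    exists B, 0%N; split => // x xi xB; rewrite expr0 mulr1 row_mxEl.
    exact: le_trans (rv_coord_le _ _) xB.
  exists 1, 1%N; split => // x xi _; rewrite mul1r expr1 row_mxEr.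
  exact: coord_le_japanese.
- exists (C + C'), (M + M')%N; split=> [|x xi xB]; first exact: addr_ge0.
  apply: (le_trans (ler_normD _ _)); rewrite mulrDl; apply: lerD.
    apply: (le_trans (Hu x xi xB)); rewrite ler_wpM2l // ler_weXn2l ?leq_addr //.
    exact: japanese_ge1.
  apply: (le_trans (Hv x xi xB)); rewrite ler_wpM2l // ler_weXn2l ?leq_addl //.
  exact: japanese_ge1.
- exists (C * C'), (M + M')%N; split=> [|x xi xB]; first exact: mulr_ge0.
  by rewrite normrM exprD mulrACA ler_pM // ?Hu ?Hv.
Qed.

Lemma cpoly_bound (B : R) (P : 'rV[R]_(d + n) -> R[i]) : 0 <= B -> cpoly P ->
  exists (C : R) (M : nat), 0 <= C /\ forall (x : 'rV[R]_d) (xi : 'rV[R]_n),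
    `|x| <= B -> normc (P (row_mx x xi)) <= C * japanese xi ^+ M.
Proof.
move=> B0 [/(rpoly_bound B0)[C [M [C0 H]]] /(rpoly_bound B0)[C' [M' [C0' H']]]].
exists (C + C'), (M + M')%N; split=> [|x xi xB]; first exact: addr_ge0.
apply: (le_trans (normc_le_ReIm _)); rewrite mulrDl; apply: lerD.
  apply: (le_trans (H x xi xB)); rewrite ler_wpM2l // ler_weXn2l ?leq_addr //.
  exact: japanese_ge1.
apply: (le_trans (H' x xi xB)); rewrite ler_wpM2l // ler_weXn2l ?leq_addl //.
exact: japanese_ge1.
Qed.

Lemma normc_expc N (a b : 'rV[R]_N -> R) z : normc (expc a b z) = expR (a z).
Proof.
rewrite /expc /= !exprMn -mulrDr cos2Dsin2 mulr1 sqrtr_sqr.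
by rewrite ger0_norm // expR_ge0.
Qed.

End SymbolGrowth.

Section Nets.
Variables (R : realType) (G : nat -> eps R -> R).
Hypothesis G0 : forall N e, 0 <= G N e.
Hypothesis Gmono : forall M N e, (M <= N)%N -> G M e <= G N e.

(** The growth of a net, uniformly over D, with respect to an increasing family
    G of gauges. With G N = eps^-N this is moderateness; with G constantly equal
    to eps^q or to eps^-N it is the estimate in the definition of negligible or of
    regular nets; with G constantly 1 it is the boundedness of a single function,
    seen as a constant net. All these cases then share one proof. *)
Definition uniformO (Z : Type) (D : set Z) (p : eps R -> Z -> R) : Prop :=
  exists N C eta, [/\ 0 <= C, 0 < eta &
    forall e : eps R, val e < eta -> forall z, D z -> p e z <= C * G N e].

Section UnifO.
Variables (Z : Type) (D : set Z).
Implicit Types p q : eps R -> Z -> R.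

Lemma uniformO_le (c : R) p q : 0 <= c ->
  (forall e z, D z -> p e z <= c * q e z) -> uniformO D q -> uniformO D p.
Proof.
move=> c0 pq [N [C [eta [C0 eta0 H]]]]; exists N, (c * C), eta.
split=> // [|e ee z Dz]; first exact: mulr_ge0.
apply: (le_trans (pq e z Dz)); rewrite -mulrA ler_wpM2l //; exact: H.
Qed.

Lemma uniformO_D p q : uniformO D p -> uniformO D q -> uniformO D (fun e z => p e z + q e z).
Proof.
move=> [N [C [eta [C0 eta0 H]]]] [N' [C' [eta' [C0' eta0' H']]]].
exists (maxn N N'), (C + C'), (Num.min eta eta'); split.
- exact: addr_ge0.
- by rewrite lt_min eta0.
move=> e; rewrite lt_min => /andP[ee ee'] z Dz; rewrite mulrDl; apply: lerD.
  apply: (le_trans (H e ee z Dz)); rewrite ler_wpM2l // Gmono //; exact: leq_maxl.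
apply: (le_trans (H' e ee' z Dz)); rewrite ler_wpM2l // Gmono //; exact: leq_maxr.
Qed.

Lemma uniformO_sup p : uniformO D p <->
  exists N, epsO (fun e => ereal_sup [set (p e z)%:E | z in D]) (G N).
Proof.
split=> [[N [C [eta [C0 eta0 H]]]]|[N]].
  exists N, C, eta; split=> // e ee; apply: ge_ereal_sup => _ [z Dz <-].
  by rewrite lee_fin; exact: H.
move=> /(epsO_pos (G0 N))[C [eta [C0 eta0 H]]].
exists N, C, eta; split=> //; first exact: ltW.
move=> e ee z Dz; rewrite -lee_fin; apply: le_trans (H e ee).
by apply: ereal_sup_ubound; exists z.
Qed.

Lemma uniformO_comp Z' (D' : set Z') (f : Z' -> Z) p :
  (forall z, D' z -> D (f z)) -> uniformO D p -> uniformO D' (fun e z => p e (f z)).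
Proof.
move=> fD [N [C [eta [C0 eta0 H]]]]; exists N, C, eta; split=> // e ee z Dz.
by apply: H => //; exact: fD.
Qed.

End UnifO.

Section SymbolNets.
Variables (d n : nat) (O : openset R d) (K : set 'rV[R]_d).
Hypotheses (cK : compact K) (KO : K `<=` O).
Let U := oset (cart O (whole R n)).
Let D : set ('rV[R]_d * 'rV[R]_n) := K `*` setT.
Implicit Types (f : eps R -> 'rV[R]_(d + n) -> R[i]) (k : eps R -> 'rV[R]_d -> R[i]).

Lemma domain_cart p : D p -> U (row_mx p.1 p.2).
Proof. by move=> [Kp _]; apply: cart_row_mx; exact: KO. Qed.

Definition decayO f : Prop := forall M t, uniformO D (fun e p =>
  japanese p.2 ^+ M * normc (partials t (f e) (row_mx p.1 p.2))).

Definition partialsO k : Prop := forall t, uniformO K (fun e x => normc (partials t (k e) x)).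

(** The seminorms of all orders m amount to weights <xi>^M with M natural, and
    those of sorted derivatives bound all the derivatives. *)
Lemma decayO_symbol_sn f : (forall e, smooth U (f e)) ->
  decayO f <-> forall m al be, exists N,
    epsO (fun e => symbol_sn m K al be (f e)) (G N).
Proof.
move=> sf; split=> [H m al be|H M t].
  apply/uniformO_sup; pose c := `|- m + (mdeg al)%:R| : R.
  have [M cM] : exists M : nat, c <= M%:R.
    by exists (Num.bound c); rewrite ltW // archi_boundP // normr_ge0.
  apply: (uniformO_le ler01 _ (H M (flatten
    [seq nseq (multi_cat be al i) i | i <- enum 'I_(d + n)]))) => e p Dp.
  rewrite mul1r ler_wpM2r ?normc_ge0 //.
  rewrite -powR_mulrn ?japanese_ge0 // ler_powR ?japanese_ge1 //.
  exact: le_trans (ler_norm _) cM.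
pose al : multi n := [ffun i => count_mem (rshift d i) t].
pose be : multi d := [ffun i => count_mem (lshift n i) t].
have tE : [ffun i => count_mem i t] = multi_cat be al.
  apply/ffunP => i; rewrite !ffunE; case: (split_ordP i) => j ->; by rewrite ffunE.
(* For this order m, the exponent -m + |al| of <xi> in the seminorm is M. *)
have /uniformO_sup := H ((mdeg al)%:R - M%:R) al be.
apply: uniformO_le ler01 _ => e p Dp; rewrite mul1r opprB subrK.
rewrite powR_mulrn ?japanese_ge0 // -tE.
rewrite (partials_mderiv t (oset_open _) (sf e) (domain_cart Dp)).
exact: lexx.
Qed.

Lemma partialsO_sup_deriv k : (forall e, smooth O (k e)) ->
  partialsO k <-> forall be, exists N, epsO (fun e => sup_deriv K be (k e)) (G N).
Proof.
move=> sk; split=> [H be|H t].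
  exact: (uniformO_sup _ _).1 (H (flatten [seq nseq (be i) i | i <- enum 'I_d])).
have /(uniformO_sup K) := H [ffun i => count_mem i t].
apply: uniformO_le ler01 _ => e x Kx; rewrite mul1r.
by rewrite (partials_mderiv t (oset_open _) (sk e) (KO Kx)).
Qed.

Lemma compact_bounded_norm : exists2 B : R, 0 <= B & forall x, K x -> `|x| <= B.
Proof.
have [M [_ HM]] := compact_bounded cK; exists (`|M| + 1); first exact: addr_ge0.
by move=> x; apply: HM; rewrite ltr_pwDr // ler_norm.
Qed.

(** For x in a compact set a polynomial coefficient is O(<xi>^M') for some M',
    so it only shifts M. *)
Lemma uniformO_polyop (om : 'rV[R]_(d + n) -> R) f : (forall z, 0 <= om z) ->
  (forall M t, uniformO D (fun e p => japanese p.2 ^+ M *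
    (om (row_mx p.1 p.2) * normc (partials t (f e) (row_mx p.1 p.2))))) ->
  forall T, polyop T -> forall M, uniformO D (fun e p => japanese p.2 ^+ M *
    (om (row_mx p.1 p.2) * normc (T (f e) (row_mx p.1 p.2)))).
Proof.
move=> om0 H T; have [B B0 KB] := compact_bounded_norm.
elim=> [P t pP|S {}T _ HS _ HT] M.
  have [C [M' [C0 HP]]] := cpoly_bound B0 pP.
  apply: (uniformO_le C0 _ (H (M + M')%N t)) => e p [Kp _].
  rewrite normcM exprD.
  set A := japanese p.2 ^+ M; set A' := japanese p.2 ^+ M'.
  set q := normc (partials _ _ _); set w := om _.
  have -> : A * (w * (normc (P (row_mx p.1 p.2)) * q)) =
    A * w * q * normc (P (row_mx p.1 p.2)) by ring.
  have -> : C * (A * A' * (w * q)) = A * w * q * (C * A') by ring.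
  apply: ler_wpM2l; last exact: HP (KB _ Kp).
  by rewrite !mulr_ge0 ?normc_ge0 ?exprn_ge0 ?japanese_ge0 // /w om0.
apply: (uniformO_le ler01 _ (uniformO_D (HS M) (HT M))) => e p _.
rewrite mul1r -mulrDr ler_wpM2l ?exprn_ge0 ?japanese_ge0 //.
rewrite -mulrDr ler_wpM2l //; exact: le_normcD.
Qed.

Variables a b : 'rV[R]_(d + n) -> R.
Hypotheses (pa : rpoly a) (pb : rpoly b).

Lemma decayO_expc f : (forall e, smooth U (f e)) ->
  (forall M t, uniformO D (fun e p => japanese p.2 ^+ M *
    (expR (a (row_mx p.1 p.2)) *
     normc (partials t (f e) (row_mx p.1 p.2))))) ->
  decayO (fun e z => expc a b z * f e z).
Proof.
move=> sf H M s; have [T pT E] := partials_expM pa pb s.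
have := uniformO_polyop (fun z => expR_ge0 (a z)) H pT M.
apply: uniformO_le ler01 _ => e p Dp.
by rewrite mul1r (E U (oset_open _) _ _ (sf e) (domain_cart Dp)) normcM normc_expc.
Qed.

Lemma decayO_expc_symbol (c : R) f : (forall z, a z = c) ->
  (forall e, smooth U (f e)) -> decayO f ->
  decayO (fun e z => expc a b z * f e z).
Proof.
move=> ac sf H; apply: decayO_expc => // M t.
apply: (uniformO_le (expR_ge0 c) _ (H M t)) => e p Dp.
by rewrite ac mulrCA.
Qed.

(** The Gaussian absorbs all powers of <xi>, so that bounds for k on K
    suffice. *)
Lemma decayO_expc_kernel (c : R) k : 0 <= c ->
  (forall x xi, expR (a (row_mx x xi)) <= c * gaussian xi) ->
  (forall e, smooth O (k e)) -> partialsO k ->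
  decayO (fun e z => expc a b z * k e (lsubmx z)).
Proof.
move=> c0 ag sk H; apply: (@decayO_expc (fun e z => k e (lsubmx z))).
  by move=> e; exact: smooth_lsubmx.
move=> M t; have [C C0 HC] := japanese_gaussian R n M.
have [g Hg] := partials_lsubmx O t.
case: g Hg => [s|] Hg.
  have := uniformO_comp (fun p (Dp : D p) => Dp.1) (H s).
  apply: uniformO_le (mulr_ge0 c0 C0) _ => e p Dp.
  rewrite (Hg _ (sk e) _ (domain_cart Dp)) row_mxKl mulrA ler_wpM2r ?normc_ge0 //.
  apply: (@le_trans _ _ (japanese p.2 ^+ M * (c * gaussian p.2))).
    by rewrite ler_wpM2l ?exprn_ge0 ?japanese_ge0.
  by rewrite mulrCA ler_wpM2l.
exists 0%N, 0, 1; split => // e _ p Dp.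
by rewrite (Hg _ (sk e) _ (domain_cart Dp)) normc0 !mulr0 mul0r.
Qed.

Lemma partialsO_freq_integral f : (forall e, smooth U (f e)) ->
  (forall e, weight_decay O (f e)) -> decayO f ->
  partialsO (fun e => freq_integral (f e)).
Proof.
move=> sf df H s.
have [N [C [eta [C0 eta0 HC]]]] := H (2 * n)%N (map (lshift n) s).
set W := 2 * Rintegral (leb R n) setT (fun t => weight (trow t)).
have W0 : 0 <= W.
  by rewrite mulr_ge0 //; apply: Rintegral_ge0 => t _; rewrite ltW // weight_gt0.
exists N, (W * C), eta; split=> // [|e ee x Kx]; first exact: mulr_ge0.
rewrite (partials_freq_integral s (sf e) (df e) (KO Kx)).
rewrite -mulrA; apply: (@freq_integral_bound _ _ _ O); last first.
- move=> xi; apply: le_weight; last exact: normc_ge0.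
  exact: (HC e ee (x, xi)).
- exact: KO.
- exact: smooth_partials.
Qed.

End SymbolNets.

End Nets.

(** * Passing between amplitudes and kernels *)

Section CompactSupport.
Variables (R : realType) (n : nat).
Implicit Types (u : 'rV[R]_n -> R[i]) (K : set 'rV[R]_n).

Lemma normc_bounded_on_compact u K : compact K ->
  (forall x, K x -> ccont u x) ->
  exists2 B : R, 0 <= B & forall x, K x -> normc (u x) <= B.
Proof.
move=> cK cu.
have bnd (f : 'rV[R]_n -> R) : (forall x, K x -> {for x, continuous f}) ->
    exists2 B : R, 0 <= B & forall x, K x -> `|f x| <= B.
  move=> cf; have wf : {within K, continuous f}.
    by apply: continuous_in_subspaceT => x /set_mem; exact: cf.
  have [M [_ HM]] := compact_bounded (continuous_compact wf cK).
  exists (`|M| + 1); first exact: addr_ge0.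
  by move=> x Kx; apply: HM; [rewrite ltr_pwDr // ler_norm|exists x].
have [B B0 HB] := bnd _ (fun x Kx => (cu x Kx).1).
have [B' B0' HB'] := bnd _ (fun x Kx => (cu x Kx).2).
exists (B + B'); first exact: addr_ge0.
move=> x Kx; apply: le_trans (normc_le_ReIm _) _.
by apply: lerD; [exact: HB|exact: HB'].
Qed.

Lemma weight_lower_bound K : compact K ->
  exists2 c : R, 0 < c & forall x, K x -> c <= weight x.
Proof.
move=> cK; have [B B0 HB] := compact_bounded_norm cK.
exists (\prod_(i < n) (oneDsqr B)^-1).
  by apply: prodr_gt0 => i _; rewrite invr_gt0 oneDsqr_pos.
move=> x Kx; apply: ler_prod => i _; rewrite oneDsqrV_ge0 /=.
rewrite lef_pV2 ?posrE ?oneDsqr_pos // lerD2l -real_normK ?num_real //.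
rewrite ler_pXn2r ?nnegrE //; exact: le_trans (rv_coord_le _ _) (HB x Kx).
Qed.

(** A continuous function is bounded on the compact set K, where the weight is
    bounded below. *)
Lemma compact_support_weight (O : openset R n) K u : compact K -> K `<=` O ->
  smooth O u -> (forall x, oset O x -> ~ K x -> u x = 0) ->
  exists2 C : R, 0 <= C & forall x, oset O x -> normc (u x) <= C * weight x.
Proof.
move=> cK KO su uK.
have [B B0 HB] := normc_bounded_on_compact cK
  (fun x Kx => smooth_ccont [::] su (KO x Kx)).
have [c c0 Hc] := weight_lower_bound cK.
exists (B / c); first by rewrite divr_ge0 // ltW.
move=> x Ox; have [Kx|nKx] := pselect (K x).
  apply: le_trans (HB x Kx) _; rewrite -mulrA ler_peMr //.
  by rewrite mulrC ler_pdivlMr // mul1r Hc.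
by rewrite uK // normc0 mulr_ge0 ?divr_ge0 // ltW // weight_gt0.
Qed.

End CompactSupport.

Section AmplitudeIntegral.
Variables (R : realType) (n : nat) (O : openset R n).
Local Notation T := (n.-tuple (measurableTypeR R)).
Let OO := cart O O.
Let U := oset (cart OO (whole R n)).
Variables (H : 'rV[R]_((n + n) + n) -> R[i]) (u : 'rV[R]_n -> R[i])
  (x : 'rV[R]_n) (K : set 'rV[R]_n).
Hypotheses (sH : smooth U H) (dH : weight_decay OO H) (su : smooth O u)
  (Ox : oset O x) (cK : compact K) (KO : K `<=` O)
  (uK : forall y, oset O y -> ~ K y -> u y = 0).

Let D := [set t : T | oset O (trow t)].
Let F (p : T * T) : R[i] :=
  H (row_mx (row_mx x (trow p.1)) (trow p.2)) * u (trow p.1).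

Lemma cart_row_mx2 y : oset O y -> oset OO (row_mx x y).
Proof. by move=> Oy; split; rewrite ?row_mxKl ?row_mxKr. Qed.

Lemma measurable_domain : measurable D.
Proof.
exact: (measurable_preimage_open (@measurable_trow_coord R n) (oset_open O)).
Qed.

Lemma amplitude_measurable : cmeasurable [set p : T * T | D p.1] F.
Proof.
pose phi (p : T * T) := row_mx (row_mx x (trow p.1)) (trow p.2).
have m1 i : measurable_fun setT (fun p : T * T => trow p.1 0 i).
  by apply: (measurableT_comp (@measurable_trow_coord R n i)); exact: measurable_fst.
have m2 i : measurable_fun setT (fun p : T * T => trow p.2 0 i).
  by apply: (measurableT_comp (@measurable_trow_coord R n i)); exact: measurable_snd.
have mphi : forall i, measurable_fun setT (fun p => phi p 0 i).
  apply: measurable_row_mx m2; apply: measurable_row_mx m1 => i.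
  exact: measurable_cst.
have preU : phi @^-1` U = [set p : T * T | D p.1].
  apply/seteqP; split=> p; rewrite /phi /U /OO /= /cart_set /= row_mxKl.
    by move=> [[_]]; rewrite row_mxKr.
  by rewrite row_mxKl row_mxKr.
pose H2 z := H z * u (rsubmx (lsubmx z)).
have cH z : U z -> ccont H2 z.
  move=> Uz; apply: ccontM; first exact: (smooth_ccont [::] sH Uz).
  have [[_ Oz] _] := Uz.
  apply: (@ccont_lsubmx _ _ _ (fun z => u (rsubmx z))); apply: ccont_rsubmx.
  exact: (smooth_ccont [::] su Oz).
have FE : F = H2 \o phi by apply/funext => p; rewrite /H2 /= row_mxKl row_mxKr.
have oU : open U by exact: oset_open.
rewrite -preU FE; split.
  exact: (@measurable_comp_continuous _ _ _ _ phi mphi U (re_fun H2) oU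
    (fun z Uz => (cH z Uz).1)).
exact: (@measurable_comp_continuous _ _ _ _ phi mphi U (im_fun H2) oU
  (fun z Uz => (cH z Uz).2)).
Qed.

(** H decays in xi uniformly for y in the support of u, and u, being bounded
    with compact support, is dominated by the weight in y. *)
Lemma amplitude_bound : exists C : R, forall p : T * T, D p.1 ->
  normc (F p) <= C * (weight (trow p.1) * weight (trow p.2)).
Proof.
have [C C0 HC] := compact_support_weight cK KO su uK.
have cK' : compact ((fun y => row_mx x y) @` K).
  apply: continuous_compact cK; apply: continuous_subspaceT => y.
  exact: continuous_row_mxr.
have KO' : (fun y => row_mx x y) @` K `<=` OO.
  by move=> _ [y /KO Oy <-]; exact: cart_row_mx2.
have [C' HC'] := dH [::] cK' KO'.
exists (`|C'| * C) => p Dp; rewrite /F normcM [weight _ * _]mulrC mulrACA.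
have C'w : 0 <= `|C'| * weight (trow p.2) by rewrite mulr_ge0 // ltW // weight_gt0.
(* Off K the bound on H is not available, but u vanishes. *)
have [Kp|nKp] := pselect (K (trow p.1)); last first.
  by rewrite uK // normc0 mulr0 !mulr_ge0 // ltW // weight_gt0.
rewrite ler_pM ?normc_ge0 //; last exact: HC.
apply: (@le_trans _ _ (C' * weight (trow p.2))).
  by apply: HC'; exists (trow p.1).
by rewrite ler_wpM2r ?ler_norm // ltW // weight_gt0.
Qed.

Lemma amplitude_cintegrable :
  cintegrable (leb R n \x leb R n)%E [set p : T * T | D p.1] F.
Proof.
have [C HC] := amplitude_bound.
have mD : measurable [set p : T * T | D p.1].
  rewrite -[X in measurable X]setTI; apply: measurable_fst => //.
  exact: measurable_domain.
have iW := integrableZl measurableT C (@integrable_weight2 R n).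
apply: (cintegrable_dom mD amplitude_measurable (integrableS measurableT mD _ iW)) => //.
Qed.

Lemma amplitude_fubini :
  Cintegral (leb R n \x leb R n)%E [set p : T * T | D p.1] F =
  kernel_integral O (freq_integral H) u x.
Proof.
have [C HC] := amplitude_bound.
rewrite (Cintegral_fubini_weight measurable_domain amplitude_measurable HC).
apply: eq_Cintegral => t Dt; rewrite /F /= mulrC -CintegralZl //.
  by apply: eq_Cintegral => s _; rewrite mulrC.
by apply: cintegrable_slice sH dH _; exact: cart_row_mx2.
Qed.

End AmplitudeIntegral.

Section AmplitudesAndKernels.
Variables (R : realType) (n : nat) (O : openset R n).
Local Notation T := (n.-tuple (measurableTypeR R)).
Local Notation N3 := ((n + n) + n)%N.
Let OO := cart O O.
Let U := oset (cart OO (whole R n)).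

Definition phase (z : 'rV[R]_N3) : R := \sum_(i < n)
  (z 0 (lshift n (lshift n i)) - z 0 (lshift n (rshift n i))) *
  z 0 (rshift (n + n) i).

Lemma phaseE x y xi : phase (row_mx (row_mx x y) xi) = dot (x - y) xi.
Proof.
apply: eq_bigr => i _.
by rewrite !row_mxEl !row_mxEr !mxE.
Qed.

Lemma rpoly_phase : rpoly phase.
Proof.
apply: (@rpoly_sum _ _ _ _ (fun i z => (z 0 (lshift n (lshift n i)) -
  z 0 (lshift n (rshift n i))) * z 0 (rshift (n + n) i))) => i.
by apply: rpolyM; [apply: rpolyB|]; exact: rpoly_coord.
Qed.

(** The logarithm of c e^(-|xi|^2); a Gaussian amplitude thereby is of the form
    [expc] as well. *)
Definition log_gaussian (c : R) (z : 'rV[R]_N3) : R :=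
  ln c + \sum_(i < n) - (z 0 (rshift (n + n) i) ^+ 2).

Lemma rpoly_log_gaussian c : rpoly (log_gaussian c).
Proof.
have -> : log_gaussian c = cst (ln c) + (fun z : 'rV[R]_N3 =>
  \sum_(i < n) - (z 0 (rshift (n + n) i) ^+ 2)) by [].
apply: rpolyD; first exact: rpoly_cst.
apply: (@rpoly_sum _ _ _ _ (fun i z => - (z 0 (rshift (n + n) i) ^+ 2))) => i.
by apply: rpolyN; apply: rpolyM; exact: rpoly_coord.
Qed.

Lemma expR_log_gaussian c w xi : 0 < c ->
  expR (log_gaussian c (row_mx w xi)) = c * gaussian xi.
Proof.
move=> c0; rewrite /log_gaussian expRD lnK ?posrE //; congr (_ * expR _).
by apply: eq_bigr => i _; rewrite row_mxEr.
Qed.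

Definition fourier_factor : R := (2 * pi) ^- n.

Lemma fourier_factor_gt0 : 0 < fourier_factor.
Proof. by rewrite invr_gt0 exprn_gt0 // mulr_gt0 // pi_gt0. Qed.

(** The integral of e^(-|xi|^2) over R^n. *)
Definition gauss_norm : R := Num.sqrt pi ^+ n.

(** The coefficient that gives a Gaussian of total mass (2 pi)^n. *)
Definition gauss_factor : R := fourier_factor^-1 / gauss_norm.

Lemma gauss_norm_gt0 : 0 < gauss_norm.
Proof. by rewrite exprn_gt0 // sqrtr_gt0 pi_gt0. Qed.

Lemma gauss_factor_gt0 : 0 < gauss_factor.
Proof. by rewrite divr_gt0 ?gauss_norm_gt0 // invr_gt0 fourier_factor_gt0. Qed.

(** The factor (2 pi)^-n is put in the exponent, so that the integrand is a
    symbol multiplied by a single [expc]. *)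
Definition amplitude_kernel (a : 'rV[R]_N3 -> R[i]) : 'rV[R]_(n + n) -> R[i] :=
  freq_integral (fun z => expc (cst (ln fourier_factor)) phase z * a z).

Definition kernel_amplitude (k : 'rV[R]_(n + n) -> R[i]) : 'rV[R]_N3 -> R[i] :=
  fun z => expc (log_gaussian gauss_factor) (- phase) z * k (lsubmx z).

Lemma expc_phase (c : R) x y xi : 0 < c ->
  expc (cst (ln c)) phase (row_mx (row_mx x y) xi) =
  c%:C * expi (dot (x - y) xi).
Proof.
move=> cp; rewrite /expc /expi phaseE lnK ?posrE //.
by apply/eqP; rewrite eq_complex /= !mul0r subr0 addr0 !eqxx.
Qed.

Lemma expc_phase_cancel w xi :
  expc (cst (ln fourier_factor)) phase (row_mx w xi) *
  expc (log_gaussian gauss_factor) (- phase) (row_mx w xi) =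
  (gauss_norm^-1 * gaussian xi)%:C.
Proof.
rewrite /expc expR_log_gaussian ?gauss_factor_gt0 //.
rewrite lnK ?posrE ?fourier_factor_gt0 //.
set p := phase _; have -> : (- phase) (row_mx w xi) = - p by [].
rewrite cosN sinN; have cs := cos2Dsin2 p.
have E : fourier_factor * gauss_factor = gauss_norm^-1.
  by rewrite /gauss_factor mulVKf // gt_eqF // fourier_factor_gt0.
apply/eqP; rewrite eq_complex /=; apply/andP; split; apply/eqP; last by ring.
transitivity (fourier_factor * gauss_factor * gaussian xi *
  (cos p ^+ 2 + sin p ^+ 2)); first by ring.
by rewrite cs mulr1 E.
Qed.

(** The two phases cancel and leave k w times a Gaussian of total mass 1. *)
Lemma kernel_amplitudeK k w : amplitude_kernel (kernel_amplitude k) w = k w.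
Proof.
have cg : cintegrable (leb R n) setT (fun t : T => (gaussian (trow t))%:C).
  by split; [exact: integrable_gaussian|exact: integrable0].
transitivity (Cintegral (leb R n) setT (fun t : T =>
    (gauss_norm^-1%:C * k w) * (gaussian (trow t))%:C)).
  apply: eq_Cintegral => t _; rewrite /kernel_amplitude row_mxKl mulrA.
  by rewrite expc_phase_cancel rmorphM /= mulrAC.
rewrite CintegralZl //.
have -> : Cintegral (leb R n) setT (fun t : T => (gaussian (trow t))%:C) =
    gauss_norm%:C.
  apply/eqP; rewrite eq_complex /=; apply/andP; split; apply/eqP.
    by rewrite /Rintegral integral_gaussian.
  by rewrite /Rintegral integral0_eq.
by rewrite mulrAC -rmorphM /= mulVf ?mul1r // gt_eqF // gauss_norm_gt0.
Qed.

(** The integral defining the operator is absolutely convergent, because the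
    amplitude decays in xi and u has compact support in y; hence the integral
    over xi can be done first. *)
Lemma amplitude_kernel_pdo a u x K :
  smooth U a ->
  (forall c, weight_decay OO (fun z => expc (cst (ln c)) phase z * a z)) ->
  smooth O u -> oset O x -> compact K -> K `<=` O ->
  (forall y, oset O y -> ~ K y -> u y = 0) ->
  pdo_integral O a u x = kernel_integral O (amplitude_kernel a) u x.
Proof.
move=> sa da su Ox cK KO uK.
have oU : open U by exact: oset_open.
have s0 := smooth_expM (rpoly_cst _ (ln fourier_factor)) rpoly_phase oU sa.
have s1 := smooth_expM (rpoly_cst _ (ln 1)) rpoly_phase oU sa.
rewrite /amplitude_kernel -(amplitude_fubini s0 (da _) su Ox cK KO uK).
rewrite /pdo_integral -/fourier_factor.
have i1 := amplitude_cintegrable s1 (da _) su Ox cK KO uK.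
have mD : measurable [set p : T * T | oset O (trow p.1)].
  have := @measurable_fst _ _ T T measurableT _ (measurable_domain O).
  by rewrite setTI.
transitivity (fourier_factor%:C * Cintegral (leb R n \x leb R n)%E
    [set p : T * T | oset O (trow p.1)] (fun p =>
      expc (cst (ln 1)) phase (row_mx (row_mx x (trow p.1)) (trow p.2)) *
      a (row_mx (row_mx x (trow p.1)) (trow p.2)) * u (trow p.1))).
  congr (_ * _); apply: eq_Cintegral => p _.
  by rewrite expc_phase // mul1r.
rewrite -CintegralZl //; apply: eq_Cintegral => p _.
by rewrite !expc_phase ?fourier_factor_gt0 // mul1r !mulrA.
Qed.

End AmplitudesAndKernels.

(** * Nets of amplitudes and nets of kernels *)

Section SingleFunctions.
Variable R : realType.

Definition unit_gauge (_ : nat) (_ : eps R) : R := 1.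

Lemma unit_gauge_ge0 N e : 0 <= unit_gauge N e. Proof. exact: ler01. Qed.

Lemma unit_gauge_mono M N e : (M <= N)%N -> unit_gauge M e <= unit_gauge N e.
Proof. by []. Qed.

Lemma eps_small (eta : R) : 0 < eta -> exists e : eps R, val e < eta.
Proof.
move=> eta0; pose t := Num.min (eta / 2) 1.
have t0 : (0 < t) && (t <= 1).
  by rewrite lt_min divr_gt0 //= ltr01 ge_min lexx orbT.
exists (exist _ t t0) => /=; rewrite gt_min ltr_pdivrMr // ltr_pMr //.
by rewrite ltr1n.
Qed.

Lemma epsO_unit (p : \bar R) :
  (exists N, epsO (fun=> p) (unit_gauge N)) <-> (p < +oo)%E.
Proof.
split=> [[N [C [eta [/eps_small[e ee] /(_ e ee) pC]]]]|].
  exact: le_lt_trans pC (ltry _).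
case: p => // [r|] _; exists 0%N.
  by exists r, 1; split => // e _; rewrite mulr1.
by exists 0, 1; split => // e _; rewrite leNye.
Qed.

Section Symbols.
Variables (d n : nat) (O : openset R d).
Let U := oset (cart O (whole R n)).
Implicit Types (f : 'rV[R]_(d + n) -> R[i]).

Lemma is_symbolP f : is_symbol O f <-> smooth U f /\
  forall K, compact K -> K `<=` O -> decayO unit_gauge K (fun=> f).
Proof.
have E K (cK : compact K) (KO : K `<=` O) (sf : smooth U f) :=
  decayO_symbol_sn unit_gauge_ge0 KO (fun=> sf).
split=> -[sf H]; split; [exact: sf| |exact: sf|].
  move=> K cK KO; apply/(E K cK KO sf) => m al be; apply/epsO_unit.
  exact: (H (m, exist _ K (conj cK KO), al, be)).
move=> j; have [cK KO] := svalP j.1.1.2.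
exact: (epsO_unit _).1 ((E _ cK KO sf).1 (H _ cK KO) j.1.1.1 j.1.2 j.2).
Qed.

Lemma decayO_weight_decay f :
  (forall K, compact K -> K `<=` O -> decayO unit_gauge K (fun=> f)) ->
  weight_decay O f.
Proof.
move=> H s K cK KO.
have [N [C [eta [C0 /eps_small[e ee] HC]]]] := H K cK KO (2 * n)%N s.
exists C => x xi Kx; apply: le_weight; last exact: normc_ge0.
by have := HC e ee (x, xi); rewrite /unit_gauge mulr1; apply.
Qed.

End Symbols.

Lemma partialsO_unit d (O : openset R d) (k : 'rV[R]_d -> R[i]) K :
  compact K -> K `<=` O -> smooth O k -> partialsO unit_gauge K (fun=> k).
Proof.
move=> cK KO sk t; have [B B0 HB] := normc_bounded_on_compact cK
  (fun x Kx => smooth_ccont t sk (KO x Kx)).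
by exists 0%N, B, 1; split => // e _ x Kx; rewrite mulr1; exact: HB.
Qed.

End SingleFunctions.

Section KernelAmplitude.
Variables (R : realType) (n : nat) (O : openset R n).
Let OO := cart O O.
Let U := oset (cart OO (whole R n)).

Lemma symbol_exp_decayO (c : R) G
  (Gm : forall M N e, (M <= N)%N -> G M e <= G N e)
  (a : eps R -> 'rV[R]_(n + n + n) -> R[i]) K :
  (forall e, smooth U (a e)) -> compact K -> K `<=` OO -> decayO G K a ->
  decayO G K (fun e z => expc (cst (ln c)) (@phase R n) z * a e z).
Proof.
move=> sa cK KO H.
exact: (decayO_expc_symbol Gm cK KO (rpoly_cst _ (ln c)) (rpoly_phase R n)
  (fun=> erefl) sa H).
Qed.

Lemma symbol_exp_smooth (c : R) (a : 'rV[R]_(n + n + n) -> R[i]) :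
  smooth U a -> smooth U (fun z => expc (cst (ln c)) (@phase R n) z * a z).
Proof.
apply: (smooth_expM (rpoly_cst _ (ln c)) (rpoly_phase R n)); exact: oset_open.
Qed.

Lemma symbol_exp_decay (c : R) (a : 'rV[R]_(n + n + n) -> R[i]) :
  is_symbol OO a ->
  weight_decay OO (fun z => expc (cst (ln c)) (@phase R n) z * a z).
Proof.
move=> /is_symbolP[sa Ha]; apply: decayO_weight_decay => K cK KO.
exact: (symbol_exp_decayO c (@unit_gauge_mono R) (fun=> sa)
  cK KO (Ha K cK KO)).
Qed.

Lemma smooth_amplitude_kernel (a : 'rV[R]_(n + n + n) -> R[i]) :
  is_symbol OO a -> smooth OO (amplitude_kernel a).
Proof.
move=> Sa; apply: smooth_freq_integral; last exact: symbol_exp_decay.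
by apply: symbol_exp_smooth; case: Sa.
Qed.

Lemma amplitude_kernelB (a a' : 'rV[R]_(n + n + n) -> R[i]) w :
  is_symbol OO a -> is_symbol OO a' -> oset OO w ->
  amplitude_kernel (a - a') w = amplitude_kernel a w - amplitude_kernel a' w.
Proof.
move=> Sa Sa' Ow; rewrite /amplitude_kernel /freq_integral -CintegralB //.
- by apply: eq_Cintegral => t _; rewrite !fctE mulrBr.
- apply: cintegrable_slice (symbol_exp_decay _ Sa) Ow.
  by apply: symbol_exp_smooth; case: Sa.
- apply: cintegrable_slice (symbol_exp_decay _ Sa') Ow.
  by apply: symbol_exp_smooth; case: Sa'.
Qed.

Lemma kernel_amplitudeB (k k' : 'rV[R]_(n + n) -> R[i]) :
  kernel_amplitude (k - k') = kernel_amplitude k - kernel_amplitude k'.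
Proof. by apply/funext => z; rewrite /kernel_amplitude !fctE mulrBr. Qed.

Lemma kernel_amplitude_decayO G
  (Gm : forall M N e, (M <= N)%N -> G M e <= G N e)
  (k : eps R -> 'rV[R]_(n + n) -> R[i]) K :
  (forall e, smooth OO (k e)) -> compact K -> K `<=` OO -> partialsO G K k ->
  decayO G K (fun e => kernel_amplitude (k e)).
Proof.
move=> sk cK KO H.
apply: (decayO_expc_kernel Gm cK KO _ _ (ltW (gauss_factor_gt0 R n)) _ sk H).
- exact: rpoly_log_gaussian.
- exact: rpolyN (rpoly_phase R n).
- by move=> x xi; rewrite expR_log_gaussian // gauss_factor_gt0.
Qed.

Lemma is_symbol_kernel_amplitude (k : 'rV[R]_(n + n) -> R[i]) :
  smooth OO k -> is_symbol OO (kernel_amplitude k).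
Proof.
move=> sk; apply/is_symbolP; split.
  exact: (smooth_expM (rpoly_log_gaussian _ _) (rpolyN (rpoly_phase R n))
    (oset_open _) (smooth_lsubmx sk)).
move=> K cK KO.
exact: (kernel_amplitude_decayO (@unit_gauge_mono R)
  (fun=> sk) cK KO (partialsO_unit cK KO sk)).
Qed.

Section Growth.
Variable G : nat -> eps R -> R.
Hypotheses (G0 : forall N e, 0 <= G N e)
  (Gm : forall M N e, (M <= N)%N -> G M e <= G N e).
Variable K : set 'rV[R]_(n + n).
Hypotheses (cK : compact K) (KO : K `<=` OO).

Lemma amplitude_kernel_growth (a : eps R -> symbol n OO) :
  (forall m al be, exists N, epsO (fun e => symbol_sn m K al be (a e)) (G N)) ->
  forall be, exists N,
    epsO (fun e => sup_deriv K be (amplitude_kernel (a e))) (G N).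
Proof.
have Sa e : is_symbol OO (a e) by exact/asboolP/symbol_is_symbol.
have sa e : smooth U (a e) by case: (Sa e).
move=> /(decayO_symbol_sn G0 KO sa) /(symbol_exp_decayO (fourier_factor R n) Gm sa cK KO) H.
apply/(partialsO_sup_deriv G0 KO (fun e => smooth_amplitude_kernel (Sa e))).
apply: (partialsO_freq_integral KO _ _ H) => e.
  exact: symbol_exp_smooth.
exact: symbol_exp_decay.
Qed.

Lemma kernel_amplitude_growth (k : eps R -> cinf OO) :
  (forall be, exists N, epsO (fun e => sup_deriv K be (k e)) (G N)) ->
  forall m al be, exists N,
    epsO (fun e => symbol_sn m K al be (kernel_amplitude (k e))) (G N).
Proof.
have sk e : smooth OO (k e) by exact/asboolP/cinf_smooth.
move=> /(partialsO_sup_deriv G0 KO sk) /(kernel_amplitude_decayO Gm sk cK KO) H.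
by apply/(decayO_symbol_sn G0 KO (fun e => (is_symbol_kernel_amplitude (sk e)).1)).
Qed.

End Growth.

Lemma sup_deriv_congr (K : set 'rV[R]_(n + n)) be f g : K `<=` OO ->
  (forall w, oset OO w -> f w = g w) -> sup_deriv K be f = sup_deriv K be g.
Proof.
move=> KO fg; rewrite /sup_deriv /mderiv; congr ereal_sup.
apply/seteqP; split=> _ [w Kw <-]; exists w => //;
  by rewrite (partials_congr (oset_open OO) fg) //; exact: KO.
Qed.

Definition amplitude_kernel_cinf (a : symbol n OO) : cinf OO :=
  Cinf (introT (asboolP _)
    (smooth_amplitude_kernel (elimT (asboolP _) (symbol_is_symbol a)))).

Definition kernel_amplitude_symbol (k : cinf OO) : symbol n OO :=
  Symbol (introT (asboolP _)
    (is_symbol_kernel_amplitude (elimT (asboolP _) (cinf_smooth k)))).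

Lemma modnetB (E : snspace R) (u v : modnet E) e : (u - v) e = u e - v e.
Proof. by []. Qed.

Lemma symbol_funB (a a' : symbol n OO) :
  symbol_fun (a - a') = symbol_fun a - symbol_fun a'.
Proof. by []. Qed.

Lemma cinf_funB (k k' : cinf OO) : cinf_fun (k - k') = cinf_fun k - cinf_fun k'.
Proof. by []. Qed.

Lemma net_moderate (E : snspace R) (u : modnet E) : moderate u.
Proof. exact/asboolP/modnet_moderate. Qed.

Fact amplitude_kernel_moderate (a : modnet (symbol_space n OO)) :
  (fun e => amplitude_kernel_cinf (a e)) \in @moderate_pred R (cinf_space OO).
Proof.
apply/asboolP => -[[K [cK KO]] be].
apply: (amplitude_kernel_growth (@epsXN_ge0 R) (fun M N e => @epsXN_le R M N e)
  cK KO) => m al be'.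
exact: (net_moderate a (m, exist _ K (conj cK KO), al, be')).
Qed.

Definition amplitude_kernel_net (a : modnet (symbol_space n OO)) :
  modnet (cinf_space OO) := ModNet (amplitude_kernel_moderate a).

Fact kernel_amplitude_moderate (k : modnet (cinf_space OO)) :
  (fun e => kernel_amplitude_symbol (k e)) \in @moderate_pred R (symbol_space n OO).
Proof.
apply/asboolP => -[[[m [K [cK KO]]] al] be].
apply: (kernel_amplitude_growth (@epsXN_ge0 R) (fun M N e => @epsXN_le R M N e)
  cK KO) => be'.
exact: (net_moderate k (exist _ K (conj cK KO), be')).
Qed.

Definition kernel_amplitude_net (k : modnet (cinf_space OO)) :
  modnet (symbol_space n OO) := ModNet (kernel_amplitude_moderate k).

(** By linearity this is the growth estimate for the net a - a'. *)
Lemma amplitude_kernel_class a a' : class_of a = class_of a' ->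
  class_of (amplitude_kernel_net a) = class_of (amplitude_kernel_net a').
Proof.
move=> /class_ofP neg; apply/class_ofP => -[[K [cK KO]] be] q.
have [|_] := @amplitude_kernel_growth (fun _ e => val e ^+ q)
  (fun _ => @epsX_ge0 R q) (fun _ _ _ _ => lexx _) K cK KO
  (fun e => (a - a' : modnet (symbol_space n OO)) e) _ be.
  move=> m al be'; exists 0%N.
  exact: (neg (m, exist _ K (conj cK KO), al, be') q).
congr (epsO _ _); apply/funext => e; apply: sup_deriv_congr => // w Ow.
rewrite !modnetB symbol_funB cinf_funB.
exact: (amplitude_kernelB (elimT (asboolP _) (symbol_is_symbol (a e)))
  (elimT (asboolP _) (symbol_is_symbol (a' e))) Ow).
Qed.

(** Likewise the growth estimate for the net k - k'. *)
Lemma kernel_amplitude_class k k' : class_of k = class_of k' ->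
  class_of (kernel_amplitude_net k) = class_of (kernel_amplitude_net k').
Proof.
move=> /class_ofP neg; apply/class_ofP => -[[[m [K [cK KO]]] al] be] q.
have [|_] := @kernel_amplitude_growth (fun _ e => val e ^+ q)
  (fun _ => @epsX_ge0 R q) (fun _ _ _ _ => lexx _) K cK KO
  (fun e => (k - k' : modnet (cinf_space OO)) e) _ m al be.
  by move=> be'; exists 0%N; exact: (neg (exist _ K (conj cK KO), be') q).
congr (epsO _ _); apply/funext => e; congr (symbol_sn _ _ _ _ _).
by rewrite !modnetB cinf_funB kernel_amplitudeB symbol_funB.
Qed.

(** The good representative a' of the symbol depends on K, whereas the kernel
    must have a single one. But the kernels of a and a' differ by a negligible
    net, whose derivatives are all O(1) on K, so the bound for a' holds for a. *)
Lemma amplitude_kernel_regular a : symbol_rg (class_of a) ->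
  calGinfty (class_of (amplitude_kernel_net a)).
Proof.
move=> rg; exists (amplitude_kernel_net a) => // K cK KO.
have [a' /amplitude_kernel_class/esym/class_ofP neg [N aN]] := rg K cK KO.
exists N => be; pose j : compact_in OO * multi (n + n) := (exist _ K (conj cK KO), be).
have [|_ H] := @amplitude_kernel_growth (fun _ e => val e ^- N)
  (fun _ => @epsXN_ge0 R N) (fun _ _ _ _ => lexx _) K cK KO a' _ be.
  by move=> m al be'; exists 0%N; exact: aN.
have H0 : epsO (fun e => @sn R (cinf_space OO) j ((amplitude_kernel_net a - amplitude_kernel_net a'
    : modnet (cinf_space OO)) e)) (fun e => val e ^- N).
  (* Negligibility is used at the order q = 0 only, as 1 <= eps^-N. *)
  apply: epsO_gauge (neg j 0%N) => e; first exact: epsX_ge0.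
  by have := @epsXN_le R 0 N e (leq0n N); rewrite !expr0 invr1.
apply: epsO_le (epsO_D H0 H) => e.
apply: le_trans (@snD_le R (cinf_space OO) j _ (amplitude_kernel_net a' e)).
by rewrite /= subrK.
Qed.

(** A single good representative of the kernel serves all K at once. *)
Lemma kernel_amplitude_regular k : calGinfty (class_of k) ->
  symbol_rg (class_of (kernel_amplitude_net k)).
Proof.
move=> [k' /kernel_amplitude_class kk' H] K cK KO.
exists (kernel_amplitude_net k') => //.
have [N HN] := H K cK KO; exists N => m al be.
by have [|_] := @kernel_amplitude_growth (fun _ e => val e ^- N)
  (fun _ => @epsXN_ge0 R N) (fun _ _ _ _ => lexx _) K cK KO k' _ m al be;
  first by move=> be'; exists 0%N; exact: HN.
Qed.

Lemma pdo_amplitude_kernel (u : calGc O) (ue : modnet (cinf_space O))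
    (a : symbol n OO) e x : compact_repr u ue -> oset O x ->
  pdo_integral O a (ue e) x = kernel_integral O (amplitude_kernel a) (ue e) x.
Proof.
move=> [_ [K [cK KO uK]]] Ox.
have Sa : is_symbol OO a by exact/asboolP/symbol_is_symbol.
apply: (@amplitude_kernel_pdo _ _ _ _ _ _ K) => //.
- by case: Sa.
- by move=> c; exact: symbol_exp_decay.
- exact/asboolP/cinf_smooth.
- exact: uK.
Qed.

Lemma pdo_kernel_amplitude (u : calGc O) (ue : modnet (cinf_space O))
    (k : cinf OO) e x : compact_repr u ue -> oset O x ->
  pdo_integral O (kernel_amplitude k) (ue e) x = kernel_integral O k (ue e) x.
Proof.
move=> cu Ox.
rewrite (pdo_amplitude_kernel (kernel_amplitude_symbol k) e cu Ox).
by apply: eq_Cintegral => t _; rewrite kernel_amplitudeK.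
Qed.

Lemma amplitude_has_kernel (A : calGc O -> calG O) a : has_amplitude A a ->
  exists2 ae, class_of ae = a & has_kernel A (class_of (amplitude_kernel_net ae)).
Proof.
move=> [ae <- H]; exists ae => //; exists (amplitude_kernel_net ae) => // u ue cu.
have [we cw E] := H u ue cu; exists we => // e x Ox.
by rewrite E // (pdo_amplitude_kernel _ _ cu).
Qed.

Lemma kernel_has_amplitude (A : calGc O -> calG O) k : has_kernel A k ->
  exists2 ke, class_of ke = k & has_amplitude A (class_of (kernel_amplitude_net ke)).
Proof.
move=> [ke <- H]; exists ke => //; exists (kernel_amplitude_net ke) => // u ue cu.
have [we cw E] := H u ue cu; exists we => // e x Ox.
by rewrite E // (pdo_kernel_amplitude _ _ cu).
Qed.

End KernelAmplitude.

Theorem proposition2p3 (R : realType) (n : nat) (Omega : openset R n)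
    (A : {linear calGc Omega -> calG Omega}) :
  (generalized_kernel_operator A <-> smoothing_pdo A) /\
  (regular_kernel_operator A <-> regular_smoothing_pdo A).
Proof.
split; split.
- move=> [k /kernel_has_amplitude[ke _ H]].
  by exists (class_of (kernel_amplitude_net ke)).
- move=> [a /amplitude_has_kernel[ae _ H]].
  by exists (class_of (amplitude_kernel_net ae)).
- move=> [k rk /kernel_has_amplitude[ke kE H]].
  exists (class_of (kernel_amplitude_net ke)) => //.
  by apply: kernel_amplitude_regular; rewrite kE.
- move=> [a ra /amplitude_has_kernel[ae aE H]].
  exists (class_of (amplitude_kernel_net ae)) => //.
  by apply: amplitude_kernel_regular; rewrite aE.
Qed.
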